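(* Let $1\leqslant p<\infty$ and let $V$ be the Volterra operator on $L_p[0,1]$, $Vf(x)=\int_0^x f(t)\,dt$. If $T\in L(L_p[0,1])$ satisfies $TV=VT$, then $T$ is not weakly supercyclic.
   Context: Scalars are $\mathbb{K}\in\{\mathbb{R},\mathbb{C}\}$. For a Banach space $X$, $L(X)$ is the space of bounded linear operators on $X$. An operator $T\in L(X)$ is weakly supercyclic if there is $x\in X$ such that the projective orbit $O_{\rm pr}(x,T)=\{zT^nx:z\in\mathbb{K},\ n\in\mathbb{Z}_+\}$ is dense in $X$ with respect to the weak topology. *)

(* Defs.v *)
From HB Require Import structures.
From mathcomp Require Import all_boot all_order all_algebra.
From mathcomp Require Import all_classical all_reals all_analysis.
From mathcomp Require Import complex.
Set Implicit Arguments. Unset Strict Implicit. Unset Printing Implicit Defensive.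
Import Order.TTheory GRing.Theory Num.Theory.
Import numFieldNormedType.Exports.
Local Open Scope classical_set_scope.
Local Open Scope ring_scope.

(* All functions are represented as complex-valued functions R -> R[i].
   The scalar field K is R (cplx = false: values and scalars must be real,
   i.e. have zero imaginary part) or C = R[i] (cplx = true). *)
Section Volterra.
Variable R : realType.
Local Notation C := (complex.complex R).

Definition mu := (@lebesgue_measure R).

Definition inK (cplx : bool) (z : C) : bool := cplx || (complex.Im z == 0).

Definition pint (p : R) (f : R -> C) : \bar R :=
  (\int[mu]_(x in `[(0%R:R), (1%R:R)]%classic) ((complex.ComplexField.Normc.normc (f x)) `^ p)%:E)%E.

Definition in_Lp (cplx : bool) (p : R) (f : R -> C) : Prop :=
  [/\ (forall x, inK cplx (f x)),
      measurable_fun `[(0%R:R), (1%R:R)] (fun x => complex.Re (f x)),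
      measurable_fun `[(0%R:R), (1%R:R)] (fun x => complex.Im (f x)) &
      (pint p f < +oo)%E].

Definition lpnorm (p : R) (f : R -> C) : R := (fine (pint p f)) `^ p^-1.

Definition cint (a b : R) (f : R -> C) : C :=
  complex.Complex (Rintegral mu `[a, b] (fun t => complex.Re (f t)))
                  (Rintegral mu `[a, b] (fun t => complex.Im (f t))).

Definition volterra (f : R -> C) : R -> C := fun x => cint 0 x f.

(* bounded linear operator on L_p[0,1] (acting on representatives;
   linearity holds in L_p, i.e. up to null functions) *)
Definition bounded_op (cplx : bool) (p : R) (T : (R -> C) -> (R -> C)) : Prop :=
  [/\ (forall f, in_Lp cplx p f -> in_Lp cplx p (T f)),
      (forall (a : C) f g, inK cplx a -> in_Lp cplx p f -> in_Lp cplx p g ->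
         lpnorm p (fun x => T (fun y => a * f y + g y) x - (a * T f x + T g x)) = 0) &
      exists M : R, forall f, in_Lp cplx p f -> lpnorm p (T f) <= M * lpnorm p f].

Definition bounded_functional (cplx : bool) (p : R) (phi : (R -> C) -> C) : Prop :=
  [/\ (forall f, in_Lp cplx p f -> inK cplx (phi f)),
      (forall (a : C) f g, inK cplx a -> in_Lp cplx p f -> in_Lp cplx p g ->
         phi (fun y => a * f y + g y) = a * phi f + phi g) &
      exists M : R, forall f, in_Lp cplx p f ->
         complex.ComplexField.Normc.normc (phi f) <= M * lpnorm p f].

Definition commutes_with_volterra (cplx : bool) (p : R)
    (T : (R -> C) -> (R -> C)) : Prop :=
  forall f : R -> C, in_Lp cplx p f -> lpnorm p (fun x => T (volterra f) x - volterra (T f) x) = 0.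

(* weak supercyclicity: some x whose projective orbit {z T^n x} meets every
   basic weak neighbourhood {y : |phi_i y - phi_i g| < eps, i < m} of every g *)
Definition weakly_supercyclic (cplx : bool) (p : R) (T : (R -> C) -> (R -> C)) : Prop :=
  exists x : R -> C, in_Lp cplx p x /\
    forall g : R -> C, in_Lp cplx p g ->
    forall (m : nat) (phi : 'I_m -> (R -> C) -> C),
      (forall i, bounded_functional cplx p (phi i)) ->
    forall eps : R, 0 < eps ->
    exists (z : C) (n : nat), inK cplx z /\
      forall i, complex.ComplexField.Normc.normc (phi i (fun t => z * iter n T x t) - phi i g) < eps.

End Volterra.

(* Main.v *)
(* Let [V] be the Volterra operator, [D] the multiplication by the variable, so that
   [D V - V D = V^2], and let [b f g] be the value at [1] of the convolution of [V^2 f] and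
   [V^2 g].  [V] is [b]-symmetric and the powers [V^n 1] span a dense subspace, so every
   bounded operator commuting with [V] is [b]-symmetric.  This applies to the powers of [T]
   and, by the commutation rule, to [T' T^k] with [T' = D T - T D].

   Let [u] be a vector whose projective orbit is weakly dense.  Symmetry gives
   [alpha (T^n u) = n * beta (T^n u)] for the functionals [alpha f = b (D f) (T u) - b f (T (D u))]
   and [beta f = b f (T' u)].  Hence [alpha / beta] takes only natural values on the projective
   orbit and cannot approach [-1]; weak density then forces [beta = 0], next [b f (T' g) = 0]
   and finally [b (D f) g = b f (D g)] for all [f] and [g].  The latter fails for [f = 1]
   and [g = V 1]. *)
Require Import Defs.
From HB Require Import structures.
From mathcomp Require Import all_boot all_order all_algebra.
From mathcomp Require Import all_classical all_reals all_analysis.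
From mathcomp Require Import measurable_realfun complex ring lra.
Set Implicit Arguments. Unset Strict Implicit. Unset Printing Implicit Defensive.
Import Order.TTheory GRing.Theory Num.Theory.
Import numFieldNormedType.Exports.
Local Open Scope classical_set_scope.
Local Open Scope ring_scope.

(** * Primitives of integrable real functions on the unit interval *)

Section RealVolterra.
Variable R : realType.
Local Notation mu := (@lebesgue_measure R).
Implicit Types (f g : R -> R) (x y t : R).

(** Why density forces [beta = 0]: on the orbit vector of index [n], [alpha + beta] equals
    [(n + 1) * beta]. Two orbit vectors with nonzero [beta] would thus combine into a vector with
    [alpha + beta = 0] and [beta] nonzero, where the ratio is [-1]. So [beta] survives on at most
    one orbit vector [e]. Near any vector with nonzero [beta] the projective orbit then offers only
    multiples of [e], and every bounded functional becomes a multiple of [beta], which the dimension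
    of [L_p] forbids.

    Why [b] applies [V] twice: the first [V] makes the arguments primitives, and these are the
    vectors that polynomials are shown to approximate, uniformly; the second makes the integrand of
    the convolution continuous, so that the form is controlled by [L_1] norms and integration by
    parts applies.

    Operators act on representatives. Identities between them hold almost everywhere on the unit
    interval, and it is boundedness that carries them through operators and functionals. *)

Definition integrable01 f : Prop := mu.-integrable `[0, 1] (EFin \o f).

(** Values outside the unit interval are arbitrary, hence excluded from the comparison. The codomain
    is free in order to cover real and complex functions. *)
Definition ae01 (S : Type) (f g : R -> S) : Prop :=
  {ae mu, forall x, 0 <= x <= 1 -> f x = g x}.

Lemma ae01_of_all (S : Type) (f g : R -> S) :
  (forall x, 0 <= x <= 1 -> f x = g x) -> ae01 f g.
Proof. by move=> fg; apply: (@filterE _ _ (ae_filter_ringOfSetsType mu)). Qed.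

Lemma ae01_map (S S' : Type) (F : R -> S -> S') (f g : R -> S) :
  ae01 f g -> ae01 (fun x => F x (f x)) (fun x => F x (g x)).
Proof.
by apply: (@filterS _ _ (ae_filter_ringOfSetsType mu)) => x fg /fg ->.
Qed.

Lemma ae01_map2 (S1 S2 S' : Type) (F : R -> S1 -> S2 -> S')
    (f1 g1 : R -> S1) (f2 g2 : R -> S2) : ae01 f1 g1 -> ae01 f2 g2 ->
  ae01 (fun x => F x (f1 x) (f2 x)) (fun x => F x (g1 x) (g2 x)).
Proof.
apply: (@filterS2 _ _ (ae_filter_ringOfSetsType mu)) => x fg1 fg2 x01.
by rewrite fg1// fg2.
Qed.

Lemma ae01_sym (S : Type) (f g : R -> S) : ae01 f g -> ae01 g f.
Proof.
by apply: (@filterS _ _ (ae_filter_ringOfSetsType mu)) => x fg /fg ->.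
Qed.

Lemma ae01_trans (S : Type) (f g h : R -> S) : ae01 f g -> ae01 g h -> ae01 f h.
Proof.
by apply: (@filterS2 _ _ (ae_filter_ringOfSetsType mu)) => x fg gh x01; rewrite fg// gh.
Qed.

Definition rvolterra f : R -> R := fun x => Rintegral mu `[0, x] f.

Definition norm1 f : R := Rintegral mu `[0, 1] (fun x => `|f x|).

Lemma integrable01_continuous f :
  {within `[0, 1], continuous f} -> integrable01 f.
Proof. by apply: continuous_compact_integrable; exact: segment_compact. Qed.

Lemma integrable01_cst c : integrable01 (fun=> c).
Proof.
by apply: integrable01_continuous; apply: continuous_subspaceT => x; exact: cvg_cst.
Qed.

Lemma eq_integrable01 f g : (forall x, 0 <= x <= 1 -> f x = g x) ->
  integrable01 f -> integrable01 g.
Proof.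
move=> fg; apply: eq_integrable => // x; rewrite inE/= in_itv/= => x01.
by rewrite fg.
Qed.

Lemma integrable01_lin a f g : integrable01 f -> integrable01 g ->
  integrable01 (fun x => a * f x + g x).
Proof. by move=> fi gi; exact: (integrableD _ (integrableZl _ a fi) gi). Qed.

Lemma integrable01_norm f : integrable01 f -> integrable01 (fun x => `|f x|).
Proof. by move=> fi; exact: integrable_norm. Qed.

Lemma integrable01_mulx f : integrable01 f -> integrable01 (fun x => x * f x).
Proof.
move=> fi; have mf := measurable_int _ fi; move/measurable_EFinP in mf.
apply: le_integrable fi => //=.
  by apply/measurable_EFinP; apply: measurable_funM => //.
move=> x; rewrite in_itv/= => /andP[x0 x1].
by rewrite lee_fin normrM ler_piMl// ger0_norm.
Qed.

Lemma integrable01S f x : 0 <= x <= 1 -> integrable01 f ->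
  mu.-integrable `[0, x] (EFin \o f).
Proof.
move=> /andP[x0 x1]; apply: integrableS => //.
by apply: subset_itvl; rewrite bnd_simp.
Qed.

Lemma eq_rvolterra f g x : 0 <= x <= 1 ->
  (forall t, 0 <= t <= 1 -> f t = g t) -> rvolterra f x = rvolterra g x.
Proof.
move=> /andP[x0 x1] fg; apply: eq_Rintegral => t; rewrite inE/= in_itv/= => /andP[t0 tx].
by apply: fg; rewrite t0 (le_trans tx).
Qed.

Lemma ae_eq_rvolterra f g x : 0 <= x <= 1 -> integrable01 f -> integrable01 g ->
  ae01 f g -> rvolterra f x = rvolterra g x.
Proof.
move=> x01 fi gi fg; congr fine; apply: ae_eq_integral => //.
- by have := measurable_int _ (integrable01S x01 fi).
- by have := measurable_int _ (integrable01S x01 gi).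
- case/andP : x01 => x0 x1; move: fg; apply: (@filterS _ _ (ae_filter_ringOfSetsType mu)) => t fg; rewrite /= in_itv/= => /andP[t0 tx].
  by rewrite /= fg// t0 (le_trans tx).
Qed.

Lemma rvolterra_lin a f g x : 0 <= x <= 1 -> integrable01 f -> integrable01 g ->
  rvolterra (fun t => a * f t + g t) x = a * rvolterra f x + rvolterra g x.
Proof.
move=> x01 fi gi; rewrite /rvolterra RintegralD//; last exact: integrable01S.
  by rewrite RintegralZl//; exact: integrable01S.
exact: (integrableZl _ a (integrable01S x01 fi)).
Qed.

Lemma rvolterra0 f : rvolterra f 0 = 0.
Proof. by rewrite /rvolterra set_itv1 Rintegral_set1. Qed.

Lemma rvolterra_cst c x : 0 <= x -> rvolterra (fun=> c) x = c * x.
Proof.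
move=> x0; rewrite /rvolterra Rintegral_cst//= lebesgue_measure_itv/= lte_fin.
by case: ltgtP x0 => // [x0|<-] _; rewrite /= ?subr0 ?mulr0.
Qed.

Lemma rvolterraB f x y : 0 <= x -> x <= y -> y <= 1 -> integrable01 f ->
  rvolterra f y - rvolterra f x = Rintegral mu `]x, y] f.
Proof.
move=> x0 xy y1 fi; apply: Rintegral_itvB; rewrite ?bnd_simp//.
by apply: integrable01S => //; rewrite y1 (le_trans x0 xy).
Qed.

Lemma integrable01Soc f x y : 0 <= x -> y <= 1 -> integrable01 f ->
  mu.-integrable `]x, y] (EFin \o f).
Proof.
move=> x0 y1; apply: integrableS => // t /=; rewrite !in_itv/= => /andP[xt ty].
by rewrite (le_trans x0 (ltW xt)) (le_trans ty y1).
Qed.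

(** Taken between [0] and [1], this also serves as the comparison principle for integrals over the
    whole interval. *)
Lemma rvolterra_incr_le f g x y : 0 <= x -> x <= y -> y <= 1 ->
  integrable01 f -> integrable01 g ->
  (forall t, x < t <= y -> `|f t| <= g t) ->
  `|rvolterra f y - rvolterra f x| <= rvolterra g y - rvolterra g x.
Proof.
move=> x0 xy y1 fi gi fg; rewrite !rvolterraB//.
have fxy := integrable01Soc x0 y1 fi; have gxy := integrable01Soc x0 y1 gi.
apply: le_trans (le_normr_Rintegral _ fxy) _ => //.
by apply: le_Rintegral => //; exact: integrable_norm.
Qed.

Lemma norm1E f : norm1 f = rvolterra (fun x => `|f x|) 1.
Proof. by []. Qed.

Lemma rvolterra_norm_mono f x y : 0 <= x -> x <= y -> y <= 1 -> integrable01 f ->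
  rvolterra (fun t => `|f t|) x <= rvolterra (fun t => `|f t|) y.
Proof.
move=> x0 xy y1 fi; have nfi := integrable01_norm fi.
rewrite -subr_ge0; apply: le_trans (@rvolterra_incr_le (fun=> 0) _ x y _ _ _ _ _ _) => //.
  exact: integrable01_cst.
by move=> t _; rewrite normr0.
Qed.

Lemma rvolterra_incr_norm f x y : 0 <= x -> x <= y -> y <= 1 -> integrable01 f ->
  `|rvolterra f y - rvolterra f x| <=
  rvolterra (fun t => `|f t|) y - rvolterra (fun t => `|f t|) x.
Proof. by move=> *; apply: rvolterra_incr_le => //; exact: integrable01_norm. Qed.

Lemma rvolterra_le f x : 0 <= x <= 1 -> integrable01 f -> `|rvolterra f x| <= norm1 f.
Proof.
move=> /andP[x0 x1] fi; have := rvolterra_incr_norm (lexx 0) x0 x1 fi.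
rewrite !rvolterra0 !subr0 => h; apply: le_trans h _; rewrite norm1E.
exact: rvolterra_norm_mono.
Qed.

Lemma rvolterra_continuous f : integrable01 f -> {within `[0, 1], continuous (rvolterra f)}.
Proof. by move=> fi; exact: parameterized_integral_continuous. Qed.

Lemma integrable01_rvolterra f : integrable01 f -> integrable01 (rvolterra f).
Proof. by move=> fi; exact/integrable01_continuous/rvolterra_continuous. Qed.

(** Absolute continuity of the integral: the increment is an integral over an interval of measure
    below [d]. This is the modulus of continuity that [weierstrass] asks for. *)
Lemma rvolterra_unif f (e : R) : integrable01 f -> 0 < e ->
  exists2 d : R, 0 < d & forall x y, 0 <= x <= 1 -> 0 <= y <= 1 -> `|x - y| < d ->
    `|rvolterra f x - rvolterra f y| <= e.
Proof.
move=> fi e0; pose g : R -> R := f \_ `[0, 1].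
have gi : mu.-integrable setT (EFin \o g).
  by rewrite -restrict_EFin; apply/integrable_restrict => //=; rewrite setTI.
have [d [d0 hd]] := integral_normr_continuous gi e0.
exists d => // x y.
wlog : x y / x <= y => [W|xy x01 y01 xyd].
  case: (leP x y) => [/W//|/ltW /W h x01 y01]; rewrite distrC => xyd.
  by rewrite distrC; exact: h.
case/andP : x01 => x0 x1; case/andP : y01 => y0 y1.
rewrite distrC rvolterraB//; apply: le_trans (le_normr_Rintegral _ _) _ => //.
  exact: integrable01Soc.
apply: ltW; rewrite [ltLHS](_ : _ = \int[mu]_(t in `]x, y]) `|g t|).
  apply: hd => //=; rewrite lebesgue_measure_itv/= lte_fin.
  case: ifPn => // xy'; rewrite -EFinB lte_fin.
  by rewrite distrC ger0_norm ?subr_ge0// in xyd.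
apply: eq_Rintegral => t; rewrite inE/= in_itv/= => /andP[xt ty].
rewrite /g patchE mem_set//= in_itv/= (le_trans x0 (ltW xt)).
exact: le_trans ty y1.
Qed.

(* Cut [0, x] into [N] equal pieces and sum the increments. *)
Lemma superlinear_incr_cst (H G : R -> R) x : 0 <= x <= 1 ->
  (forall s t, 0 <= s -> s <= t -> t <= 1 ->
    `|H t - H s| <= 2 * (t - s) * (G t - G s)) -> H x = H 0.
Proof.
move=> /andP[x0 x1] HG.
have key (N : nat) : `|H x - H 0| <= 2 * (x / N.+1%:R) * (G x - G 0).
  pose p i := x / N.+1%:R * i%:R.
  have h0 : 0 <= x / N.+1%:R by rewrite divr_ge0.
  have pN : p N.+1 = x by rewrite /p -mulrA mulVf ?mulr1// pnatr_eq0.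
  have pk k : (k <= N.+1)%N -> p k <= 1.
    by move=> kN; apply: le_trans x1; rewrite -pN ler_wpM2l// ler_nat.
  suff: forall k, (k <= N.+1)%N ->
      `|H (p k) - H 0| <= 2 * (x / N.+1%:R) * (G (p k) - G 0).
    by move=> /(_ N.+1 (leqnn _)); rewrite pN.
  elim=> [_|k ih kN]; first by rewrite /p mulr0 !subrr normr0 mulr0.
  have pkS : p k.+1 - p k = x / N.+1%:R by rewrite /p -natr1; ring.
  have pk0 : 0 <= p k by rewrite mulr_ge0.
  have ple : p k <= p k.+1 by rewrite -subr_ge0 pkS.
  have hS := HG _ _ pk0 ple (pk _ kN).
  have hk := ih (ltnW kN).
  have -> : H (p k.+1) - H 0 = (H (p k.+1) - H (p k)) + (H (p k) - H 0) by ring.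
  apply: le_trans (ler_normD _ _) _.
  apply: le_trans (lerD hS hk) _; rewrite pkS.
  by rewrite -mulrDr le_eqVlt; apply/orP; left; apply/eqP; ring.
apply/eqP; rewrite -subr_eq0 -normr_le0 leNgt; apply/negP => h0.
pose c := 2 * x * (G x - G 0).
have c0 : 0 < c.
  have := lt_le_trans h0 (key 0%N); by rewrite divr1.
have := @archi_boundP _ (c / `|H x - H 0|) (divr_ge0 (ltW c0) (ltW h0)).
set N := Num.bound _ => hN.
have := key N; rewrite leNgt => /negP; apply.
rewrite (_ : 2 * _ * _ = c / N.+1%:R); last by rewrite /c; ring.
rewrite ltr_pdivrMr// mulrC -ltr_pdivrMr//.
by apply: lt_trans hN _; rewrite ltr_nat.
Qed.

(** For [f] merely integrable, the difference [H] of the two sides cannot be differentiated at every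
    point. Its increments are instead bounded by [2 * (t - s)] times those of the primitive of
    [|f|], which makes [H] constant. *)
Lemma mulx_rvolterra f x : 0 <= x <= 1 -> integrable01 f ->
  x * rvolterra f x = rvolterra (fun t => t * f t) x + rvolterra (rvolterra f) x.
Proof.
move=> x01 fi; pose F := rvolterra f.
have nfi := integrable01_norm fi; have xfi := integrable01_mulx fi.
have Fi : integrable01 F := integrable01_rvolterra fi.
pose H x := x * F x - rvolterra (fun t => t * f t) x - rvolterra F x.
have : H x = H 0; last first.
  by rewrite /H !rvolterra0 mul0r !subr0 => /eqP; rewrite !subr_eq0 subr_eq addrC => /eqP.
apply: (@superlinear_incr_cst _ (rvolterra (fun t => `|f t|))) => // s t s0 st t1.
have t0 : 0 <= t := le_trans s0 st; have s1 : s <= 1 := le_trans st t1.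
have s01 : 0 <= s <= 1 by rewrite s0.
have t01 : 0 <= t <= 1 by rewrite t0.
(* The increment of [H] from [s] to [t] is the integral of [(t - r) * f r] minus that of
   [F r - F s]; each is at most [t - s] times the integral of [|f|] over []s, t]]. *)
pose k r := (- 1) * (r * f r) + t * f r.
pose K r := 1 * F r + (- F s).
have tfi : integrable01 (fun r => t * f r).
  have := integrable01_lin t fi (integrable01_cst 0).
  by apply: eq_integrable01 => r _; rewrite addr0.
have ki : integrable01 k by exact: integrable01_lin.
have Ki : integrable01 K by apply: integrable01_lin => //; exact: integrable01_cst.
have lin1 c r : 0 <= r <= 1 -> rvolterra (fun t => c * f t) r = c * F r.
  move=> r01; have := rvolterra_lin c r01 fi (integrable01_cst 0).
  rewrite rvolterra_cst ?mul0r ?addr0; last by case/andP: r01.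
  by move=> <-; apply: eq_rvolterra => // u _; rewrite addr0.
have kE r : 0 <= r <= 1 -> rvolterra k r = t * F r - rvolterra (fun t => t * f t) r.
  by move=> r01; rewrite rvolterra_lin// lin1//; ring.
have KE r : 0 <= r <= 1 -> rvolterra K r = rvolterra F r - F s * r.
  move=> r01; rewrite rvolterra_lin//; last exact: integrable01_cst.
  by rewrite rvolterra_cst; [ring|case/andP: r01].
have -> : H t - H s = (rvolterra k t - rvolterra k s) - (rvolterra K t - rvolterra K s).
  by rewrite !kE// !KE// /H; ring.
pose h r := (t - s) * `|f r|.
have hE r : 0 <= r <= 1 -> rvolterra h r = (t - s) * rvolterra (fun t => `|f t|) r.
  move=> r01; have := rvolterra_lin (t - s) r01 nfi (integrable01_cst 0).
  rewrite rvolterra_cst ?mul0r ?addr0; last by case/andP: r01.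
  by move=> <-; apply: eq_rvolterra => // u _; rewrite addr0.
have hi : integrable01 h.
  have := integrable01_lin (t - s) nfi (integrable01_cst 0).
  by apply: eq_integrable01 => r _; rewrite addr0.
have b1 : `|rvolterra k t - rvolterra k s| <= rvolterra h t - rvolterra h s.
  apply: rvolterra_incr_le => // r /andP[sr rt].
  rewrite /k /h (_ : -1 * _ + _ = (t - r) * f r); last by ring.
  by rewrite normrM ler_wpM2r// ger0_norm ?subr_ge0// lerB// ltW.
pose M := rvolterra (fun t => `|f t|) t - rvolterra (fun t => `|f t|) s.
have b2 : `|rvolterra K t - rvolterra K s| <= M * t - M * s.
  have -> : M * t - M * s = rvolterra (cst M) t - rvolterra (cst M) s.
    by rewrite /cst !rvolterra_cst.
  apply: rvolterra_incr_le => //; first exact: integrable01_cst.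
  move=> r /andP[sr rt]; rewrite /K mul1r /cst.
  have r1 := le_trans rt t1.
  apply: le_trans (rvolterra_incr_norm s0 (ltW sr) r1 fi) _.
  by rewrite /M lerB// rvolterra_norm_mono// (le_trans s0 (ltW sr)).
rewrite !hE// in b1.
apply: le_trans (ler_normB _ _) _; apply: le_trans (lerD b1 b2) _.
by rewrite /M le_eqVlt; apply/orP; left; apply/eqP; ring.
Qed.

(** The quarter points keep away from both ends of the interval, where the polynomial of
    [bform_vpow11] vanishes. *)
Lemma rvolterra_gt0 f c : integrable01 f -> 0 < c ->
  (forall t, 0 <= t <= 1 -> 0 <= f t) -> (forall t, 1 / 4 <= t <= 3 / 4 -> c <= f t) ->
  0 < rvolterra f 1.
Proof.
move=> fi c0 f0 fc.
have mono x y : 0 <= x -> x <= y -> y <= 1 -> rvolterra f x <= rvolterra f y.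
  move=> x0 xy y1; rewrite -subr_ge0.
  apply: le_trans (@rvolterra_incr_le (fun=> 0) f x y _ _ _ _ _ _) => //.
    exact: integrable01_cst.
  by move=> t /andP[xt ty]; rewrite normr0 f0// (le_trans x0 (ltW xt)) (le_trans ty).
have low : c * (1 / 2) <= rvolterra f (3 / 4) - rvolterra f (1 / 4).
  have -> : c * (1 / 2) = rvolterra (fun=> c) (3 / 4) - rvolterra (fun=> c) (1 / 4).
    by rewrite !rvolterra_cst; [field|lra|lra].
  apply: le_trans (ler_norm _) _.
  apply: rvolterra_incr_le; [lra|lra|lra|exact: integrable01_cst|exact: fi|].
  by move=> t /andP[t1 t3]; rewrite ger0_norm ?(ltW c0)// fc// (ltW t1) t3.
have m1 : 0 <= rvolterra f (1 / 4) by rewrite -(rvolterra0 f); apply: mono; lra.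
have m2 : rvolterra f (3 / 4) <= rvolterra f 1 by apply: mono; lra.
lra.
Qed.

End RealVolterra.

(** * The convolution form on real functions *)

Section RealForm.
Variable R : realType.
Local Notation mu := (@lebesgue_measure R).
Implicit Types (f g h : R -> R) (x y t : R).

(** The convolution of the two primitives at [1]. Passing to primitives makes the integrand
    continuous and the form bounded in terms of [norm1]. *)
Definition rform f g : R :=
  Rintegral mu `[0, 1] (fun t => rvolterra f t * rvolterra g (1 - t)).

Lemma rformE f g :
  rform f g = Rintegral mu `[0, 1] (fun t => rvolterra f t * rvolterra g (1 - t)).
Proof. by []. Qed.

Lemma onem01 x : 0 <= x <= 1 -> 0 <= 1 - x <= 1.
Proof. lra. Qed.

Lemma within_continuous_onem f : {within `[0, 1], continuous f} ->
  {within `[0, 1], continuous (fun t => f (1 - t))}.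
Proof.
move=> /subspace_continuousP cf; apply/subspace_continuousP => x x01.
have y01 : `[0, 1]%classic (1 - x).
  by move: x01; rewrite /= !in_itv/=; exact: onem01.
apply: (@cvg_comp _ _ _ (fun t => 1 - t) f _ (within `[0, 1] (nbhs (1 - x)))); last exact: cf.
move=> A; rewrite /within/= => hA.
have c : {for x, continuous (fun t : R => 1 - t)}.
  by apply: continuousB; [exact: cvg_cst|exact: cvg_id].
apply: (@filterS _ (nbhs x) _ _ _ _ (c _ hA)) => t /= hA' t01; apply: hA'.
by move: t01; rewrite /= !in_itv/=; exact: onem01.
Qed.

Lemma within_continuousM f g : {within `[0, 1], continuous f} ->
  {within `[0, 1], continuous g} -> {within `[0, 1], continuous (fun t => f t * g t)}.
Proof. by move=> cf cg x; apply: continuousM; [exact: cf|exact: cg]. Qed.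

Lemma rform_integrand_continuous f g : integrable01 f -> integrable01 g ->
  {within `[0, 1], continuous (fun t => rvolterra f t * rvolterra g (1 - t))}.
Proof.
move=> fi gi; apply: within_continuousM; first exact: rvolterra_continuous.
by apply: within_continuous_onem; exact: rvolterra_continuous.
Qed.

Lemma rform_sym f g : integrable01 f -> integrable01 g -> rform f g = rform g f.
Proof.
move=> fi gi; rewrite /rform.
have c := rform_integrand_continuous fi gi.
have r01 : 0 <= (1 : R) <= 1 by rewrite ler01 lexx.
rewrite (Rintegration_by_substitution_onem r01 c).
rewrite unstable.onem1; apply: eq_Rintegral => t _.
by rewrite /unstable.onem subKr mulrC.
Qed.

Lemma rform_linl a f g h : integrable01 f -> integrable01 g -> integrable01 h ->
  rform (fun x => a * f x + g x) h = a * rform f h + rform g h.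
Proof.
move=> fi gi hi; rewrite /rform.
have ifh := integrable01_continuous (rform_integrand_continuous fi hi).
have igh := integrable01_continuous (rform_integrand_continuous gi hi).
rewrite -RintegralZl// -RintegralD//; last exact: (integrableZl _ a ifh).
apply: eq_Rintegral => t; rewrite inE/= in_itv/= => t01.
by rewrite rvolterra_lin// mulrDl mulrA.
Qed.

Lemma ae01_rforml f g h : integrable01 f -> integrable01 g -> ae01 f g ->
  rform f h = rform g h.
Proof.
move=> fi gi fg; apply: eq_Rintegral => t; rewrite inE/= in_itv/= => t01.
by rewrite (ae_eq_rvolterra t01 fi gi fg).
Qed.

Lemma rform_le f g : integrable01 f -> integrable01 g ->
  `|rform f g| <= norm1 f * norm1 g.
Proof.
move=> fi gi; pose k t := rvolterra f t * rvolterra g (1 - t).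
have ki : integrable01 k := integrable01_continuous (rform_integrand_continuous fi gi).
have := @rvolterra_incr_le _ k (fun=> norm1 f * norm1 g) 0 1 (lexx 0) ler01 (lexx 1) ki
  (integrable01_cst _).
rewrite !rvolterra0 rvolterra_cst// mulr1 !subr0; apply.
move=> t /andP[t0 t1]; have t01 : 0 <= t <= 1 by rewrite ltW.
by rewrite /k normrM ler_pM//; apply: rvolterra_le => //; exact: onem01.
Qed.

Lemma rvolterra_derivable f : {within `[0, 1], continuous f} ->
  derivable_oo_LRcontinuous (rvolterra f) 0 1 /\ {in `]0, 1[, derive1 (rvolterra f) =1 f}.
Proof.
move=> cf; have fi := integrable01_continuous cf.
have [_ c0 c1] := (continuous_within_itvP _ ltr01).1 (rvolterra_continuous fi).
have [cf' _ _] := (continuous_within_itvP _ ltr01).1 cf.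
have d t : t \in `]0, 1[ -> derivable (rvolterra f) t 1 /\ derive1 (rvolterra f) t = f t.
  move=> t01; have := t01; rewrite in_itv/= => /andP[t0 t1].
  by apply: (continuous_FTC1_closed t1 fi t0); exact: cf'.
by split=> [|t /d[]//]; split => // t /d[].
Qed.

Lemma rvolterra_onem_derivable f : {within `[0, 1], continuous f} ->
  derivable_oo_LRcontinuous (fun t => - rvolterra f (1 - t)) 0 1 /\
  {in `]0, 1[, derive1 (fun t => - rvolterra f (1 - t)) =1 (fun t => f (1 - t))}.
Proof.
move=> cf; have fi := integrable01_continuous cf.
have [[df _ _] ddf] := rvolterra_derivable cf.
have c : {within `[0, 1], continuous (fun t => - rvolterra f (1 - t))}.
  have /subspace_continuousP c := within_continuous_onem (rvolterra_continuous fi).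
  by apply/subspace_continuousP => x x01; apply: cvgN; exact: c.
have [_ c0 c1] := (continuous_within_itvP _ ltr01).1 c.
have d t : t \in `]0, 1[ -> is_derive t 1 (fun t => - rvolterra f (1 - t)) (f (1 - t)).
  move=> t01; have t01' : 1 - t \in `]0, 1[.
    by move: t01; rewrite !in_itv/=; lra.
  have h1 : is_derive (1 - t) 1 (rvolterra f) (f (1 - t)).
    apply: DeriveDef; first exact: df.
    by rewrite -derive1E ddf.
  have h2 := is_deriveB (is_derive_cst (1 : R) t 1) (is_derive_id t (1 : R)).
  have := is_deriveN (@is_derive1_comp _ (rvolterra f) _ t _ _ h1 h2).
  by rewrite sub0r mulrN1 opprK.
split; first by split; [move=> t /d[]|exact: c0|exact: c1].
by move=> t /d[_]; rewrite derive1E.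
Qed.

(** Integration by parts with [- rvolterra g (1 - t)], a primitive of [g (1 - t)]; the boundary
    terms vanish because both primitives are zero at [0]. *)
Lemma rvolterra_by_parts f g : {within `[0, 1], continuous f} ->
  {within `[0, 1], continuous g} ->
  Rintegral mu `[0, 1] (fun t => rvolterra f t * g (1 - t)) =
  Rintegral mu `[0, 1] (fun t => f t * rvolterra g (1 - t)).
Proof.
move=> cf cg; have fi := integrable01_continuous cf.
have gi := integrable01_continuous cg.
have [df ddf] := rvolterra_derivable cf.
have [dg ddg] := rvolterra_onem_derivable cg.
have := Rintegration_by_parts ltr01 cf df ddf (within_continuous_onem cg) dg ddg.
rewrite subrr !rvolterra0 oppr0 mulr0 mul0r subrr sub0r => ->.
under eq_Rintegral do rewrite mulrN -mulN1r.
rewrite RintegralZl ?mulN1r ?opprK//.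
apply: integrable01_continuous; apply: within_continuousM => //.
by apply: within_continuous_onem; exact: rvolterra_continuous.
Qed.

Lemma rform_rvolterra f g : integrable01 f -> integrable01 g ->
  rform (rvolterra f) g = rform f (rvolterra g).
Proof. by move=> fi gi; apply: rvolterra_by_parts; exact: rvolterra_continuous. Qed.

Lemma rform0r f : rform f (fun=> 0) = 0.
Proof.
rewrite /rform (_ : Rintegral _ _ _ = rvolterra (fun=> 0) 1); first by rewrite rvolterra_cst// mul0r.
apply: eq_Rintegral => t; rewrite inE/= in_itv/= => /andP[t0 t1].
by rewrite rvolterra_cst ?mul0r ?mulr0// subr_ge0.
Qed.

Lemma rform0l f : rform (fun=> 0) f = 0.
Proof.
rewrite /rform (_ : Rintegral _ _ _ = rvolterra (fun=> 0) 1); first by rewrite rvolterra_cst// mul0r.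
apply: eq_Rintegral => t; rewrite inE/= in_itv/= => /andP[t0 t1].
by rewrite rvolterra_cst ?mul0r.
Qed.

End RealForm.

(** * Uniform approximation by Bernstein polynomials *)

Section Bernstein.
Variable R : realType.
Implicit Types (phi psi : nat -> R) (x : R).

(* The value of the [n]-th Bernstein polynomial of [phi], i.e. the mean of [phi] at the
   number of successes of [n] Bernoulli([x]) trials, conditioned on the first trial. *)
Fixpoint bernstein n phi x : R :=
  if n is m.+1 then x * bernstein m (phi \o S) x + (1 - x) * bernstein m phi x
  else phi 0%N.

Lemma bernstein_le n phi psi x : 0 <= x <= 1 -> (forall k, (k <= n)%N -> phi k <= psi k) ->
  bernstein n phi x <= bernstein n psi x.
Proof.
move=> /andP[x0 x1]; elim: n phi psi => [|n ih] phi psi h /=; first exact: h.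
apply: lerD; apply: ler_wpM2l; rewrite ?subr_ge0//; apply: ih => k kn; apply: h => //.
exact: leqW.
Qed.

Lemma bernstein_lin n a phi psi x :
  bernstein n (fun k => a * phi k + psi k) x = a * bernstein n phi x + bernstein n psi x.
Proof.
elim: n phi psi => [//|n ih] phi psi /=.
by rewrite ih [X in x * X](_ : _ = a * bernstein n (phi \o S) x + bernstein n (psi \o S) x);
  [ring|rewrite -ih].
Qed.

Lemma bernstein_cst n c x : bernstein n (fun=> c) x = c.
Proof.
elim: n => [//|n ih] /=.
rewrite [X in x * X](_ : _ = bernstein n (fun=> c) x)// ih; ring.
Qed.

(** Squared bias plus binomial variance. The centre [a] stays general in the induction because a
    first success shifts it to [a - 1]. *)
Lemma bernstein_sqr n a x :
  bernstein n (fun k => (k%:R - a) ^+ 2) x = (n%:R * x - a) ^+ 2 + n%:R * x * (1 - x).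
Proof.
elim: n a => [|n ih] a /=; first by rewrite !mul0r addr0.
rewrite ih (_ : bernstein n _ x = bernstein n (fun k => (k%:R - (a - 1)) ^+ 2) x); last first.
  by congr bernstein; apply/funext => k /=; rewrite -natr1; congr (_ ^+ 2); ring.
by rewrite ih -natr1; ring.
Qed.

(** Bernstein's argument: dominate the oscillation of [h] around [x] by a constant plus a quadratic,
    then average. The mean of the quadratic is a variance, which decays like [1 / n]. *)
Lemma weierstrass (h : R -> R) (M : R) :
  (forall x, 0 <= x <= 1 -> `|h x| <= M) ->
  (forall e : R, 0 < e -> exists2 d : R, 0 < d & forall x y : R, 0 <= x <= 1 -> 0 <= y <= 1 ->
     `|x - y| < d -> `|h x - h y| <= e) ->
  forall e : R, 0 < e -> exists n phi, forall x, 0 <= x <= 1 -> `|h x - bernstein n phi x| <= e.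
Proof.
move=> hM hu e e0; have e20 : 0 < e / 2 by rewrite divr_gt0.
have [d d0 hd] := hu _ e20.
have M0 : 0 <= M by apply: le_trans (hM 0 _) => //; rewrite lexx ler01.
(* With this [c] the quadratic term alone reaches the trivial bound [2 * M] as soon as
   [|x - y| >= d]. *)
pose c := 2 * M / d ^+ 2.
have c0 : 0 <= c by apply: divr_ge0; [exact: mulr_ge0|exact: sqr_ge0].
have quad (x y : R) : 0 <= x <= 1 -> 0 <= y <= 1 -> `|h x - h y| <= e / 2 + c * (x - y) ^+ 2.
  move=> x01 y01; case: (ltP `|x - y| d) => xy.
    by apply: le_trans (hd _ _ x01 y01 xy) _; rewrite lerDl mulr_ge0// sqr_ge0.
  apply: le_trans (ler_normB _ _) _; apply: le_trans (lerD (hM _ x01) (hM _ y01)) _.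
  have hc : 2 * M <= c * (x - y) ^+ 2.
    rewrite /c mulrAC ler_pdivlMr ?exprn_gt0// ler_wpM2l ?mulr_ge0//.
    by rewrite -(real_normK (num_real (x - y))) lerXn2r ?nnegrE ?(ltW d0).
  lra.
(* Since [x * (1 - x) <= 1], any [n >= 2 * c / e] brings the averaged quadratic down to [e / 2]. *)
have := @archi_boundP _ (2 * c / e) (divr_ge0 (mulr_ge0 (ler0n _ 2) c0) (ltW e0)).
set N := Num.bound _ => hN; pose n := N.+1; have n0 : (0 : R) < n%:R by rewrite ltr0n.
pose phi k := h (k%:R / n%:R).
exists n, phi => x x01.
have bnd : bernstein n (fun k => e / 2 + c * (k%:R / n%:R - x) ^+ 2) x <= e.
  rewrite (_ : (fun k => _) = (fun k => c / n%:R ^+ 2 * (k%:R - n%:R * x) ^+ 2 + e / 2)); last first.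
    apply/funext => k; rewrite addrC; congr (_ + _); field.
    by rewrite gt_eqF.
  rewrite bernstein_lin bernstein_cst bernstein_sqr subrr expr0n/= add0r.
  rewrite -lerBrDr (_ : e - e / 2 = e / 2); last by field.
  rewrite (_ : c / _ * _ = c * (x * (1 - x)) / n%:R); last by field; rewrite gt_eqF.
  rewrite ler_pdivrMr//; apply: (@le_trans _ _ c).
    by rewrite ler_piMr//; case/andP: x01 => x0 x1; nra.
  have : 2 * c / e <= n%:R by apply/ltW/(lt_trans hN); rewrite ltr_nat.
  rewrite ler_pdivrMr// => ?; lra.
have k01 k : (k <= n)%N -> 0 <= (k%:R / n%:R : R) <= 1.
  by move=> kn; rewrite divr_ge0//= ler_pdivrMr// mul1r ler_nat.
have q k : (k <= n)%N -> `|h x - phi k| <= e / 2 + c * (k%:R / n%:R - x) ^+ 2.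
  by move=> /k01 kn; rewrite -sqrrN opprB; exact: quad.
(* The mean is linear, monotone and fixes constants, so [h x] can be moved inside it in both
   inequalities. *)
rewrite ler_norml; apply/andP; split.
- rewrite lerNl opprB; apply: le_trans bnd.
  rewrite -[X in _ - X](bernstein_cst n (h x) x) addrC -mulN1r -bernstein_lin.
  apply: bernstein_le => // k /q; rewrite ler_norml => /andP[+ _]; lra.
- apply: le_trans bnd.
  rewrite -[X in X - _](bernstein_cst n (h x) x) addrC -mulN1r -bernstein_lin.
  apply: bernstein_le => // k /q; rewrite ler_norml => /andP[_]; lra.
Qed.

End Bernstein.

(** * Functions in [L_p] with real or complex values *)

Section ComplexLp.
Variables (R : realType) (cplx : bool) (p : R).
Hypothesis p1 : 1 <= p.
Local Notation C := (complex.complex R).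
Local Notation mu := (@lebesgue_measure R).
Local Notation normc := (@complex.ComplexField.Normc.normc R).
Local Notation Re := (@complex.Re R).
Local Notation Im := (@complex.Im R).
Local Notation X := (in_Lp cplx p).
Implicit Types (f g h : R -> C).

Let p0 : 0 < p. Proof. exact: lt_le_trans p1. Qed.

Lemma normc_ge0 (z : C) : 0 <= normc z.
Proof. by case: z => a b; exact: sqrtr_ge0. Qed.

Lemma normr_Re_le (z : C) : `|Re z| <= normc z.
Proof.
case: z => a b /=; rewrite -sqrtr_sqr ler_wsqrtr// lerDl; exact: sqr_ge0.
Qed.

Lemma normr_Im_le (z : C) : `|Im z| <= normc z.
Proof.
case: z => a b /=; rewrite -sqrtr_sqr ler_wsqrtr// lerDr; exact: sqr_ge0.
Qed.

Lemma normc_le_ReIm (z : C) : normc z <= `|Re z| + `|Im z|.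
Proof.
case: z => a b /=; rewrite -[leRHS]ger0_norm ?addr_ge0// -sqrtr_sqr ler_wsqrtr//.
by rewrite sqrrD !real_normK ?num_real// lerD2r lerDl mulrn_wge0// mulr_ge0.
Qed.

Lemma ReM (z w : C) : Re (z * w) = Re z * Re w - Im z * Im w.
Proof. by case: z w => a b [c d]. Qed.

Lemma ImM (z w : C) : Im (z * w) = Re z * Im w + Im z * Re w.
Proof. by case: z w => a b [c d]. Qed.

Lemma ReD (z w : C) : Re (z + w) = Re z + Re w.
Proof. by case: z w => a b [c d]. Qed.

Lemma ImD (z w : C) : Im (z + w) = Im z + Im w.
Proof. by case: z w => a b [c d]. Qed.

Lemma complex_ext (z w : C) : Re z = Re w -> Im z = Im w -> z = w.
Proof. by case: z w => a b [c d] /= -> ->. Qed.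

Lemma inK_lin (a z w : C) : inK cplx a -> inK cplx z -> inK cplx w -> inK cplx (a * z + w).
Proof.
rewrite /inK; case: cplx => //= /eqP a0 /eqP z0 /eqP w0.
by rewrite ImD ImM a0 z0 w0 mulr0 mul0r !addr0.
Qed.

Lemma inK_real (x : R) : inK cplx (x%:C)%C.
Proof. by rewrite /inK /= eqxx orbT. Qed.

Lemma inK1 : inK cplx (1 : C). Proof. exact: inK_real. Qed.

Lemma inKN1 : inK cplx (-1 : C).
Proof. by rewrite /inK /= oppr0 eqxx orbT. Qed.

Lemma measurable_normc_powR f :
  measurable_fun `[(0 : R), (1 : R)] (fun x => Re (f x)) -> measurable_fun `[(0 : R), (1 : R)] (fun x => Im (f x)) ->
  measurable_fun `[(0 : R), (1 : R)] (fun x => (normc (f x)) `^ p).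
Proof.
move=> mR mI; apply: (measurableT_comp (measurable_powR p)).
rewrite (_ : (fun x => normc (f x)) =
    (fun x => Num.sqrt (Re (f x) ^+ 2 + Im (f x) ^+ 2))); last first.
  by apply/funext => x; case: (f x).
apply: (measurableT_comp (continuous_measurable_fun (@sqrt_continuous R))).
by apply: measurable_funD; apply: measurable_funX.
Qed.

Lemma in_Lp_pow_integrable f : X f -> integrable01 (fun x => (normc (f x)) `^ p).
Proof.
move=> [_ mR mI fp]; apply/integrableP; split.
  by apply/measurable_EFinP; apply: measurable_normc_powR.
apply: le_lt_trans fp; rewrite le_eqVlt; apply/orP; left; apply/eqP.
by apply: eq_integral => x _ /=; rewrite ger0_norm// powR_ge0.
Qed.

(** If [y > e] then [y / e >= 1], so that [y / e] is at most its [p]-th power; multiply by [e]. *)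
Lemma le_scaled_powR (e y : R) : 0 < e -> 0 <= y -> y <= e + e / e `^ p * y `^ p.
Proof.
move=> e0 y0; have ep := powR_gt0 p e0.
have h0 : 0 <= e / e `^ p * y `^ p by rewrite mulr_ge0 ?powR_ge0// divr_ge0 ?ltW.
case: (leP y e) => ye; first by apply: le_trans ye _; rewrite lerDl.
have ye1 : 1 <= y / e by rewrite ler_pdivlMr// mul1r ltW.
have := ler_powR ye1 p1; rewrite powRr1; last exact: le_trans ye1.
move=> h; have yE : y `^ p = (y / e) `^ p * e `^ p.
  by rewrite -powRM ?divfK ?gt_eqF// ?ltW// divr_gt0// (lt_trans e0).
have -> : e / e `^ p * y `^ p = (y / e) `^ p * e.
  by rewrite yE [X in _ * X = _]mulrC mulrA divfK ?gt_eqF// mulrC.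
apply: (@le_trans _ _ ((y / e) * e)); first by rewrite divfK ?gt_eqF.
by apply: (@le_trans _ _ ((y / e) `^ p * e)); [rewrite ler_wpM2r// ltW|rewrite lerDr ltW].
Qed.

Lemma dominated_integrable01 f (r : R -> R) : X f -> measurable_fun `[(0 : R), (1 : R)] r ->
  (forall x, 0 <= x <= 1 -> `|r x| <= normc (f x)) -> integrable01 r.
Proof.
move=> Xf mr hr; have i := integrable01_lin 1 (in_Lp_pow_integrable Xf) (integrable01_cst 1).
apply: le_integrable i => //; first exact/measurable_EFinP.
move=> x; rewrite /= in_itv/= => x01; rewrite lee_fin mul1r.
apply: le_trans (hr _ x01) _; rewrite ger0_norm ?addr_ge0 ?powR_ge0//.
have := le_scaled_powR ltr01 (normc_ge0 (f x)).
by rewrite powR1 divr1 mul1r addrC.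
Qed.

(* Substitutes for Hoelder's inequality: integrate [|r| <= e + e^(1-p) |f|^p] and choose [e]. *)
Lemma dominated_norm1_le f (r : R -> R) : X f -> measurable_fun `[(0 : R), (1 : R)] r ->
  (forall x, 0 <= x <= 1 -> `|r x| <= normc (f x)) -> norm1 r <= 2 * lpnorm p f.
Proof.
move=> Xf mr hr; have ri := dominated_integrable01 Xf mr hr.
have fi := in_Lp_pow_integrable Xf; pose s := fine (pint p f).
have s0 : 0 <= s by apply: fine_ge0; apply: integral_ge0 => x _; rewrite lee_fin powR_ge0.
have key (e : R) : 0 < e -> norm1 r <= e + e / e `^ p * s.
  move=> e0; pose k x := e / e `^ p * (normc (f x)) `^ p + e.
  have ki : integrable01 k by apply: integrable01_lin => //; exact: integrable01_cst.
  have := @rvolterra_incr_le _ (fun x => `|r x|) k 0 1 (lexx 0) ler01 (lexx 1)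
    (integrable01_norm ri) ki.
  rewrite !rvolterra0 !subr0 rvolterra_lin ?ler01 ?lexx//; last exact: integrable01_cst.
  rewrite rvolterra_cst// mulr1 addrC => h; apply: le_trans (ler_norm _) (h _).
  move=> x /andP[x0 x1]; rewrite normr_id /k addrC; apply: le_trans (hr x _) _.
    by rewrite ltW.
  by apply: le_scaled_powR => //; exact: normc_ge0.
(* For [s = 0], taking half of a positive [norm1 r] as [e] is contradictory. Otherwise [e] is the
   [L_p] norm itself, which makes the two summands equal. *)
rewrite /lpnorm -/s; have [s00|sn0] := eqVneq s 0.
  rewrite s00 powR0 ?invr_eq0 ?gt_eqF// mulr0 leNgt; apply/negP => n0.
  have := key _ (divr_gt0 n0 (ltr0Sn _ 1)); rewrite s00 mulr0 addr0 leNgt => /negP; apply.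
  by rewrite ltr_pdivrMr// ltr_pMr// ltr1n.
have sgt : 0 < s by rewrite lt_neqAle eq_sym sn0.
have := key _ (powR_gt0 p^-1 sgt).
by rewrite -powRrM mulVf ?gt_eqF// powRr1// mulfVK// -mulr2n mulr_natl.
Qed.

Definition integrable01C f := integrable01 (Re \o f) /\ integrable01 (Im \o f).

(** Equivalent to the [L_1] norm, and split so that the estimates on real functions apply to each
    part. *)
Definition norm1C f : R := norm1 (Re \o f) + norm1 (Im \o f).

Lemma norm1_ge0 (r : R -> R) : 0 <= norm1 r.
Proof. by apply: Rintegral_ge0. Qed.

Lemma norm1C_ge0 f : 0 <= norm1C f.
Proof. by rewrite addr_ge0// norm1_ge0. Qed.

Lemma in_Lp_integrable f : X f -> integrable01C f.
Proof.
move=> Xf; have [_ mR mI _] := Xf.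
split; apply: (dominated_integrable01 Xf) => // x _; [exact: normr_Re_le|exact: normr_Im_le].
Qed.

Lemma norm1C_le_lpnorm f : X f -> norm1C f <= 4 * lpnorm p f.
Proof.
move=> Xf; have [_ mR mI _] := Xf.
have hR := dominated_norm1_le Xf mR (fun x _ => normr_Re_le (f x)).
have hI := dominated_norm1_le Xf mI (fun x _ => normr_Im_le (f x)).
rewrite /norm1C; move: hR hI; rewrite /comp; lra.
Qed.

Lemma lpnorm_ge0 f : 0 <= lpnorm p f.
Proof. exact: powR_ge0. Qed.

Lemma norm1_eq0 (r : R -> R) : integrable01 r -> norm1 r = 0 -> ae01 r (fun=> 0).
Proof.
move=> ri r0.
have [mr _] := integrableP _ _ _ ri.
have fi : (\int[mu]_(x in `[(0 : R)%R, (1 : R)%R]) `|(EFin \o r) x| \is a fin_num)%E.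
  by rewrite ge0_fin_numE ?integral_ge0//; case/integrableP: ri.
have : (\int[mu]_(x in `[(0 : R)%R, (1 : R)%R]) `|(EFin \o r) x| = 0)%E.
  by rewrite -(fineK fi); congr EFin.
move/(ae_eq_integral_abs _ _ mr).
move/(_ (measurable_itv _)).
apply: (@filterS _ _ (ae_filter_ringOfSetsType mu)) => x h x01.
have /= := h _; rewrite in_itv/= => /(_ x01) [].
by [].
Qed.

Lemma norm1C_eq0 f : integrable01C f -> norm1C f = 0 -> ae01 f (fun=> 0).
Proof.
move=> [iR iI] f0; have r0 : norm1 (Re \o f) = 0 /\ norm1 (Im \o f) = 0.
  move: f0 (norm1_ge0 (Re \o f)) (norm1_ge0 (Im \o f)); rewrite /norm1C; lra.
case: r0 => /(norm1_eq0 iR) hR /(norm1_eq0 iI) hI.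
by apply: (@filterS2 _ _ (ae_filter_ringOfSetsType mu)) hR hI => x hR hI x01;
  apply: complex_ext; [exact: hR|exact: hI].
Qed.

Lemma lpnorm_eq0 f : X f -> lpnorm p f = 0 -> ae01 f (fun=> 0).
Proof.
move=> Xf f0; apply: norm1C_eq0; first exact: in_Lp_integrable.
by apply/eqP; rewrite eq_le norm1C_ge0 andbT; have := norm1C_le_lpnorm Xf; rewrite f0 mulr0.
Qed.

Lemma in_Lp_of_pow_le f (h : R -> R) : (forall x, inK cplx (f x)) ->
  measurable_fun `[(0 : R), (1 : R)] (fun x => Re (f x)) -> measurable_fun `[(0 : R), (1 : R)] (fun x => Im (f x)) ->
  integrable01 h -> (forall x, 0 <= x <= 1 -> (normc (f x)) `^ p <= h x) ->
  X f /\ fine (pint p f) <= rvolterra h 1.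
Proof.
move=> Kf mR mI hi fh.
have fi : integrable01 (fun x => (normc (f x)) `^ p).
  apply: le_integrable hi => //; first by apply/measurable_EFinP; apply: measurable_normc_powR.
  move=> x; rewrite /= in_itv/= => /fh; rewrite lee_fin => h1.
  by rewrite ger0_norm ?powR_ge0//; apply: le_trans h1 (ler_norm _).
split.
  split => //; case/integrableP: fi => _.
  by under eq_integral do rewrite /= ger0_norm ?powR_ge0//.
have := @rvolterra_incr_le _ _ h 0 1 (lexx 0) ler01 (lexx 1) fi hi.
rewrite !rvolterra0 !subr0 => hh; apply: le_trans (ler_norm _) (hh _).
by move=> x /andP[x0 x1]; rewrite ger0_norm ?powR_ge0// fh// ltW.
Qed.

Lemma in_Lp_bounded f (M : R) : 0 <= M -> (forall x, inK cplx (f x)) ->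
  measurable_fun `[(0 : R), (1 : R)] (fun x => Re (f x)) -> measurable_fun `[(0 : R), (1 : R)] (fun x => Im (f x)) ->
  (forall x, 0 <= x <= 1 -> normc (f x) <= M) -> X f /\ lpnorm p f <= M.
Proof.
move=> M0 Kf mR mI fM.
have [] := @in_Lp_of_pow_le f (fun=> M `^ p) Kf mR mI (integrable01_cst _).
  by move=> x /fM h; rewrite ge0_ler_powR ?nnegrE ?normc_ge0// ltW.
rewrite rvolterra_cst// mulr1 => Xf h; split => //.
rewrite /lpnorm -[leRHS](powRr1 M0) -(mulfV (lt0r_neq0 p0)) powRrM.
rewrite ge0_ler_powR ?nnegrE ?powR_ge0 ?invr_ge0 ?(ltW p0)//.
by apply: fine_ge0; apply: integral_ge0 => x _; rewrite lee_fin powR_ge0.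
Qed.

Lemma lpnorm_le f g : X f -> X g -> (forall x, 0 <= x <= 1 -> normc (f x) <= normc (g x)) ->
  lpnorm p f <= lpnorm p g.
Proof.
move=> Xf Xg fg; have [Kf mR mI _] := Xf.
have [] := @in_Lp_of_pow_le f _ Kf mR mI (in_Lp_pow_integrable Xg).
  by move=> x /fg h; rewrite ge0_ler_powR ?nnegrE ?normc_ge0// ltW.
move=> _ h; rewrite /lpnorm ge0_ler_powR ?nnegrE ?invr_ge0 ?(ltW p0)//;
  by apply: fine_ge0; apply: integral_ge0 => x _; rewrite lee_fin powR_ge0.
Qed.

Lemma in_Lp_lin (a : C) f g : inK cplx a -> X f -> X g -> X (fun x => a * f x + g x).
Proof.
move=> Ka Xf Xg; have [Kf mRf mIf _] := Xf; have [Kg mRg mIg _] := Xg.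
(* This [c] ensures [|a f + g| <= c * max(|f|, |g|)], and the [p]-th power of the maximum is at most
   the sum of the [p]-th powers. *)
pose c := 2 * (1 + normc a).
have c0 : 0 <= c by rewrite mulr_ge0// addr_ge0// normc_ge0.
pose F x := (normc (f x)) `^ p; pose G x := (normc (g x)) `^ p.
pose h x := c `^ p * (1 * F x + G x) + 0.
have hi : integrable01 h.
  apply: integrable01_lin; last exact: integrable01_cst.
  by apply: integrable01_lin; exact: in_Lp_pow_integrable.
have [] // := @in_Lp_of_pow_le (fun x => a * f x + g x) h _ _ _ hi.
- by move=> x; exact: inK_lin.
- rewrite (_ : (fun x => _) = fun x => (Re a * Re (f x) - Im a * Im (f x)) + Re (g x)).
    apply: measurable_funD => //; apply: measurable_funB; exact: measurable_funM.
  by apply/funext => x; rewrite ReD ReM.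
- rewrite (_ : (fun x => _) = fun x => (Re a * Im (f x) + Im a * Re (f x)) + Im (g x)).
    apply: measurable_funD => //; apply: measurable_funD; exact: measurable_funM.
  by apply/funext => x; rewrite ImD ImM.
move=> x _; have nf := normc_ge0 (f x); have ng := normc_ge0 (g x); have na := normc_ge0 a.
have tri : normc (a * f x + g x) <= normc a * normc (f x) + normc (g x).
  by rewrite -ComplexField.Normc.normcM; exact: le_normcD.
rewrite /h addr0 mul1r.
have W m : 0 <= m -> normc (f x) <= m -> normc (g x) <= m ->
    (normc (a * f x + g x)) `^ p <= c `^ p * m `^ p.
  move=> m0 fm gm; rewrite -powRM//; apply: ge0_ler_powR; first exact: ltW.
  - by rewrite nnegrE normc_ge0.
  - by rewrite nnegrE mulr_ge0.
  - apply: le_trans tri _; rewrite /c; nra.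
case: (leP (normc (f x)) (normc (g x))) => fg.
  apply: le_trans (W _ ng fg (lexx _)) _.
  by rewrite ler_wpM2l ?powR_ge0// lerDr powR_ge0.
apply: le_trans (W _ nf (lexx _) (ltW fg)) _.
by rewrite ler_wpM2l ?powR_ge0// lerDl powR_ge0.
Qed.

End ComplexLp.

(** * Bounded operators modulo null functions *)

Section Operators.
Variables (R : realType) (cplx : bool) (p : R).
Hypothesis p1 : 1 <= p.
Local Notation C := (complex.complex R).
Local Notation mu := (@lebesgue_measure R).
Local Notation normc := (@complex.ComplexField.Normc.normc R).
Local Notation Re := (@complex.Re R).
Local Notation Im := (@complex.Im R).
Local Notation X := (in_Lp cplx p).
Local Notation V := (@volterra R).
Implicit Types (f g h : R -> C) (r s : R -> R) (A B : (R -> C) -> (R -> C)).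

Lemma norm1_le r s : integrable01 r -> integrable01 s ->
  (forall x, 0 <= x <= 1 -> `|r x| <= `|s x|) -> norm1 r <= norm1 s.
Proof.
move=> ri si rs.
by apply: le_Rintegral => //; exact: integrable01_norm.
Qed.

Lemma norm1_rvolterra r : integrable01 r -> norm1 (rvolterra r) <= norm1 r.
Proof.
move=> ri; apply: (@le_trans _ _ (norm1 (fun=> norm1 r))).
  apply: norm1_le; [exact: integrable01_rvolterra|exact: integrable01_cst|].
  by move=> x x01; rewrite (ger0_norm (norm1_ge0 _)); exact: rvolterra_le.
by rewrite norm1E rvolterra_cst// mulr1 ger0_norm// norm1_ge0.
Qed.

Lemma ReC_lin (a : C) f g x :
  Re (a * f x + g x) = Re a * Re (f x) + (- Im a * Im (f x) + Re (g x)).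
Proof. by rewrite ReD ReM; ring. Qed.

Lemma ImC_lin (a : C) f g x :
  Im (a * f x + g x) = Re a * Im (f x) + (Im a * Re (f x) + Im (g x)).
Proof. by rewrite ImD ImM; ring. Qed.

Lemma integrable01C_lin (a : C) f g : integrable01C f -> integrable01C g ->
  integrable01C (fun x => a * f x + g x).
Proof.
move=> [fR fI] [gR gI]; split.
- apply: eq_integrable01 (integrable01_lin (Re a) fR (integrable01_lin (- Im a) fI gR)).
  by move=> x _ /=; rewrite ReC_lin.
- apply: eq_integrable01 (integrable01_lin (Re a) fI (integrable01_lin (Im a) fR gI)).
  by move=> x _ /=; rewrite ImC_lin.
Qed.

Lemma volterra_lin (a : C) f g x : 0 <= x <= 1 -> integrable01C f -> integrable01C g ->
  V (fun t => a * f t + g t) x = a * V f x + V g x.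
Proof.
move=> x01 [fR fI] [gR gI]; apply: complex_ext.
- rewrite ReC_lin /= -!rvolterra_lin//; last exact: integrable01_lin.
  by apply: eq_rvolterra => // t _; rewrite ReC_lin.
- rewrite ImC_lin /= -!rvolterra_lin//; last exact: integrable01_lin.
  by apply: eq_rvolterra => // t _; rewrite ImC_lin.
Qed.

Lemma ae01_volterra f g x : 0 <= x <= 1 -> integrable01C f -> integrable01C g ->
  ae01 f g -> V f x = V g x.
Proof.
move=> x01 [fR fI] [gR gI] fg; apply: complex_ext.
- exact: ae_eq_rvolterra x01 fR gR (ae01_map (fun _ => Re) fg).
- exact: ae_eq_rvolterra x01 fI gI (ae01_map (fun _ => Im) fg).
Qed.

Lemma volterra_le f x : 0 <= x <= 1 -> integrable01C f -> normc (V f x) <= norm1C f.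
Proof.
move=> x01 [fR fI]; apply: le_trans (normc_le_ReIm _) _.
by apply: lerD; exact: rvolterra_le.
Qed.

Lemma in_Lp_real r (M : R) : 0 <= M -> measurable_fun `[(0 : R), (1 : R)] r ->
  (forall x, 0 <= x <= 1 -> `|r x| <= M) ->
  X (fun x => (r x)%:C)%C /\ lpnorm p (fun x => (r x)%:C)%C <= M.
Proof.
move=> M0 mr rM; apply: in_Lp_bounded => //.
- by move=> x; exact: inK_real.
- by move=> x /rM; apply: le_trans; apply: le_trans (normc_le_ReIm _) _; rewrite normr0 addr0.
Qed.

Lemma in_Lp_cst (c : R) : X (fun=> c%:C)%C.
Proof. by have [] := @in_Lp_real (fun=> c) `|c| (normr_ge0 _). Qed.

(** A primitive is bounded by [norm1C f], and bounded measurable functions lie in [L_p]. *)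
Lemma in_Lp_volterra f : X f -> X (V f).
Proof.
move=> Xf; have [fR fI] := in_Lp_integrable p1 Xf; have [Kf _ _ _] := Xf.
have [] // := @in_Lp_bounded _ cplx p p1 (V f) (norm1C f) (norm1C_ge0 _).
- move=> x; rewrite /inK; case: cplx Kf => //= Kf; apply/eqP.
  rewrite (_ : (fun t => _) = cst 0) ?Rintegral_cst ?mul0r//.
  by apply/funext => t; exact/eqP/Kf.
- by have := measurable_int _ (integrable01_rvolterra fR) => /measurable_EFinP.
- by have := measurable_int _ (integrable01_rvolterra fI) => /measurable_EFinP.
- by move=> x x01; apply: volterra_le.
Qed.

Definition mulX f : R -> C := fun x => (x%:C)%C * f x.

Lemma Re_mulX f x : Re (mulX f x) = x * Re (f x).
Proof. by rewrite /mulX ReM /= mul0r subr0. Qed.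

Lemma Im_mulX f x : Im (mulX f x) = x * Im (f x).
Proof. by rewrite /mulX ImM /= mul0r addr0. Qed.

Lemma normc_mulX f x : 0 <= x <= 1 -> normc (mulX f x) <= normc (f x).
Proof.
move=> /andP[x0 x1]; rewrite /mulX ComplexField.Normc.normcM.
rewrite -[leRHS]mul1r ler_wpM2r ?normc_ge0//.
by apply: le_trans (normc_le_ReIm _) _; rewrite /= normr0 addr0 ger0_norm.
Qed.

Lemma in_Lp_mulX f : X f -> X (mulX f).
Proof.
move=> Xf; have [Kf mR mI _] := Xf.
have [] // := @in_Lp_of_pow_le _ cplx p (mulX f) (fun x => (normc (f x)) `^ p).
- move=> x; rewrite /inK; case: cplx Kf => //= Kf; have /= /eqP := Kf x.
  by rewrite Im_mulX => ->; rewrite mulr0.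
- rewrite (_ : (fun x => _) = fun x => x * Re (f x)); first exact: measurable_funM.
  by apply/funext => x; rewrite Re_mulX.
- rewrite (_ : (fun x => _) = fun x => x * Im (f x)); first exact: measurable_funM.
  by apply/funext => x; rewrite Im_mulX.
- exact: in_Lp_pow_integrable Xf.
- move=> x x01; apply: ge0_ler_powR; rewrite ?nnegrE ?normc_ge0//.
    exact: le_trans ler01 p1.
  exact: normc_mulX.
Qed.

Lemma lpnorm_mulX f : X f -> lpnorm p (mulX f) <= lpnorm p f.
Proof.
by move=> Xf; apply: lpnorm_le (in_Lp_mulX Xf) Xf _ => // x; exact: normc_mulX.
Qed.

Lemma norm1C_mulX f : integrable01C f -> integrable01C (mulX f) /\ norm1C (mulX f) <= norm1C f.
Proof.
move=> [fR fI].
have iR : integrable01 (Re \o mulX f).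
  by apply: eq_integrable01 (integrable01_mulx fR) => x _; rewrite /= Re_mulX.
have iI : integrable01 (Im \o mulX f).
  by apply: eq_integrable01 (integrable01_mulx fI) => x _; rewrite /= Im_mulX.
split; first by [].
apply: lerD; apply: norm1_le => // x /andP[x0 x1] /=; rewrite ?Re_mulX ?Im_mulX.
  by rewrite normrM (ger0_norm x0) ler_piMl.
by rewrite normrM (ger0_norm x0) ler_piMl.
Qed.

Lemma volterra_mulX f x : 0 <= x <= 1 -> integrable01C f ->
  mulX (V f) x = V (mulX f) x + V (V f) x.
Proof.
move=> x01 [fR fI]; apply: complex_ext.
- rewrite Re_mulX ReD /= -/(rvolterra _ x) mulx_rvolterra//; congr (_ + _).
  by apply: eq_rvolterra => // t _; rewrite Re_mulX.
- rewrite Im_mulX ImD /= -/(rvolterra _ x) mulx_rvolterra//; congr (_ + _).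
  by apply: eq_rvolterra => // t _; rewrite Im_mulX.
Qed.

Lemma ae0_lpnorm f : X f -> ae01 f (fun=> 0) -> lpnorm p f = 0.
Proof.
move=> Xf f0; have p0 : 0 < p by exact: lt_le_trans p1.
suff s0 : fine (pint p f) = 0 by rewrite /lpnorm s0 powR0// invr_eq0 gt_eqF.
have h := ae01_map (fun _ z => (normc z) `^ p) f0.
have -> : fine (pint p f) = rvolterra (fun x => (normc (f x)) `^ p) 1 by [].
rewrite (ae_eq_rvolterra _ _ _ h) ?ler01 ?lexx//; last 2 first.
- exact: in_Lp_pow_integrable Xf.
- exact: integrable01_cst.
rewrite rvolterra_cst// mulr1 ComplexField.Normc.normc0 powR0//.
by rewrite gt_eqF.
Qed.

Lemma in_Lp_opp_add f g : X f -> X g -> X (fun x => -1 * f x + g x).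
Proof. by move=> Xf Xg; apply: in_Lp_lin => //; exact: inKN1. Qed.

Lemma opp_addE (z w : C) : z - w = -1 * w + z.
Proof. by rewrite mulN1r addrC. Qed.

Lemma in_Lp_sub f g : X f -> X g -> X (fun x => f x - g x).
Proof.
move=> Xf Xg; rewrite (_ : (fun x => _) = fun x => -1 * g x + f x).
  exact: in_Lp_opp_add.
by apply/funext => x; exact: opp_addE.
Qed.

(** The bound goes from [L_p] to [norm1C], the norm that controls [cform] and whose triangle
    inequality covers the difference defining [commX]. *)
Definition L1op A : Prop :=
  [/\ (forall f, X f -> X (A f)),
      (forall (a : C) f g, inK cplx a -> X f -> X g ->
         ae01 (A (fun y => a * f y + g y)) (fun x => a * A f x + A g x)) &
      exists2 M : R, 0 <= M & forall f, X f -> norm1C (A f) <= M * lpnorm p f].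

(** The form of boundedness asked of the inner factor of a composition. *)
Definition Lpop A : Prop :=
  [/\ (forall f, X f -> X (A f)),
      (forall (a : C) f g, inK cplx a -> X f -> X g ->
         ae01 (A (fun y => a * f y + g y)) (fun x => a * A f x + A g x)) &
      exists2 M : R, 0 <= M & forall f, X f -> lpnorm p (A f) <= M * lpnorm p f].

Lemma Lpop_L1op A : Lpop A -> L1op A.
Proof.
move=> [AX Al [M M0 AM]]; split => //; exists (4 * M); first exact: mulr_ge0.
move=> f Xf; apply: le_trans (norm1C_le_lpnorm p1 (AX _ Xf)) _.
by rewrite -mulrA ler_wpM2l// AM.
Qed.

Lemma ae01_sub0 f g : ae01 (fun x => f x - g x) (fun=> 0) -> ae01 f g.
Proof.
apply: (@filterS _ _ (ae_filter_ringOfSetsType mu)) => x h /h /eqP.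
by rewrite subr_eq0 => /eqP.
Qed.

Lemma bounded_op_Lpop T : bounded_op cplx p T -> Lpop T.
Proof.
move=> [TX Tl [M TM]]; split => //.
- move=> a f g Ka Xf Xg; have Xh := in_Lp_lin p1 Ka Xf Xg.
  have Xd := in_Lp_sub (TX _ Xh) (in_Lp_lin p1 Ka (TX _ Xf) (TX _ Xg)).
  exact: ae01_sub0 (lpnorm_eq0 p1 Xd (Tl _ _ _ Ka Xf Xg)).
- exists `|M| => // f Xf; apply: le_trans (TM _ Xf) _.
  by rewrite ler_wpM2r ?lpnorm_ge0// ler_norm.
Qed.

(** Compatibility with null sets comes from the bound: [A] sends the null function [f - g] to a
    function of norm zero, and [A] is linear up to null sets. *)
Lemma L1op_ae A f g : L1op A -> X f -> X g -> ae01 f g -> ae01 (A f) (A g).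
Proof.
move=> [AX Al [M M0 AM]] Xf Xg fg.
have Xh := in_Lp_opp_add Xg Xf.
have h0 : lpnorm p (fun x => -1 * g x + f x) = 0.
  apply: ae0_lpnorm => //; apply: (ae01_trans (ae01_map (fun x z => -1 * g x + z) fg)).
  by apply: ae01_of_all => x _; rewrite mulN1r addNr.
have n0 : norm1C (A (fun x => -1 * g x + f x)) = 0.
  by apply/eqP; rewrite eq_le norm1C_ge0 andbT; have := AM _ Xh; rewrite h0 mulr0.
have Ah0 := norm1C_eq0 (in_Lp_integrable p1 (AX _ Xh)) n0.
have := ae01_trans (ae01_sym (Al _ _ _ (inKN1 _ _) Xg Xf)) Ah0.
move=> h; apply: ae01_sub0; apply: ae01_trans h.
by apply: ae01_of_all => x _; exact: opp_addE.
Qed.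

Lemma L1op_comp A B : L1op A -> Lpop B -> L1op (A \o B).
Proof.
move=> oA [BX Bl [N N0 BN]]; have [AX Al [M M0 AM]] := oA.
split=> [f /BX /AX//|a f g Ka Xf Xg|].
- have Xh := BX _ (in_Lp_lin p1 Ka Xf Xg).
  have Xh' := in_Lp_lin p1 Ka (BX _ Xf) (BX _ Xg).
  have h := L1op_ae oA Xh Xh' (Bl _ _ _ Ka Xf Xg).
  exact: ae01_trans h (Al _ _ _ Ka (BX _ Xf) (BX _ Xg)).
- exists (M * N); first exact: mulr_ge0.
  move=> f Xf; apply: le_trans (AM _ (BX _ Xf)) _.
  by rewrite -mulrA ler_wpM2l// BN.
Qed.

Lemma Lpop_comp A B : Lpop A -> Lpop B -> Lpop (A \o B).
Proof.
move=> oA oB; have [h1 h2 _] := L1op_comp (Lpop_L1op oA) oB.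
case: oA oB => [AX Al [M M0 AM]] [BX Bl [N N0 BN]]; split => //.
exists (M * N); first exact: mulr_ge0.
by move=> f Xf; apply: le_trans (AM _ (BX _ Xf)) _; rewrite -mulrA ler_wpM2l// BN.
Qed.

Lemma Lpop_id : Lpop id.
Proof.
split => //; last by exists 1 => // f Xf; rewrite mul1r.
by move=> *; apply: ae01_of_all.
Qed.

Lemma Lpop_iter A n : Lpop A -> Lpop (iter n A).
Proof.
by move=> oA; elim: n => [|n ih]; [exact: Lpop_id|exact: (Lpop_comp oA ih)].
Qed.

Lemma Lpop_mulX : Lpop mulX.
Proof.
split; first exact: in_Lp_mulX.
- by move=> *; apply: ae01_of_all => x _; rewrite /mulX; ring.
- by exists 1 => // f Xf; rewrite mul1r lpnorm_mulX.
Qed.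

Lemma L1op_volterra A : L1op A -> L1op (V \o A).
Proof.
move=> [AX Al [M M0 AM]]; split=> [f /AX /in_Lp_volterra//|a f g Ka Xf Xg|].
- have Xh := in_Lp_lin p1 Ka Xf Xg.
  have Af := in_Lp_integrable p1 (AX _ Xf); have Ag := in_Lp_integrable p1 (AX _ Xg).
  apply: ae01_of_all => x x01 /=.
  rewrite (ae01_volterra x01 _ _ (Al _ _ _ Ka Xf Xg)) ?volterra_lin//.
    exact: in_Lp_integrable (AX _ Xh).
  exact: integrable01C_lin.
- exists M => // f Xf; apply: le_trans (AM _ Xf).
  have [AR AI] := in_Lp_integrable p1 (AX _ Xf).
  by apply: lerD; exact: norm1_rvolterra.
Qed.

Lemma L1op_mulX A : L1op A -> L1op (mulX \o A).
Proof.
move=> [AX Al [M M0 AM]]; split=> [f /AX /in_Lp_mulX//|a f g Ka Xf Xg|].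
- apply: ae01_trans (ae01_map (fun x z => (x%:C)%C * z) (Al _ _ _ Ka Xf Xg)) _.
  by apply: ae01_of_all => x _; rewrite /= /mulX; ring.
- exists M => // f Xf; apply: le_trans (AM _ Xf).
  by have [] := norm1C_mulX (in_Lp_integrable p1 (AX _ Xf)).
Qed.

Lemma norm1_sub r s : integrable01 r -> integrable01 s ->
  norm1 (fun x => r x - s x) <= norm1 r + norm1 s.
Proof.
move=> ri si; have nri := integrable01_norm ri; have nsi := integrable01_norm si.
have := @rvolterra_lin _ 1 (fun x => `|r x|) (fun x => `|s x|) 1.
rewrite mul1r -!norm1E => <-; rewrite ?ler01 ?lexx//.
have i1 : integrable01 (fun x => r x - s x).
  by apply: eq_integrable01 (integrable01_lin (-1) si ri) => x _; ring.
apply: le_Rintegral => //; do ?[exact: integrable01_norm|exact: integrable01_lin].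
by move=> x _; rewrite mul1r; exact: ler_normB.
Qed.

Lemma L1op_sub A B : L1op A -> L1op B -> L1op (fun f x => A f x - B f x).
Proof.
move=> [AX Al [M M0 AM]] [BX Bl [N N0 BN]]; split=> [f Xf|a f g Ka Xf Xg|].
- by apply: in_Lp_sub; [exact: AX|exact: BX].
- have := ae01_map2 (fun _ z w => z - w) (Al _ _ _ Ka Xf Xg) (Bl _ _ _ Ka Xf Xg).
  move=> h; apply: ae01_trans h _.
  by apply: ae01_of_all => x _; ring.
- exists (M + N); first exact: addr_ge0.
  move=> f Xf; rewrite mulrDl; apply: le_trans (lerD (AM _ Xf) (BN _ Xf)).
  have [AR AI] := in_Lp_integrable p1 (AX _ Xf).
  have [BR BI] := in_Lp_integrable p1 (BX _ Xf).
  rewrite /norm1C addrACA; apply: lerD.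
    rewrite (_ : _ \o _ = fun x => (Re \o A f) x - (Re \o B f) x); first exact: norm1_sub.
    by apply/funext => x /=; case: (A f x) (B f x) => ? ? [].
  rewrite (_ : _ \o _ = fun x => (Im \o A f) x - (Im \o B f) x); first exact: norm1_sub.
  by apply/funext => x /=; case: (A f x) (B f x) => ? ? [].
Qed.

End Operators.

Opaque rform.

(** * Bounded functionals and the complex form *)

Section Functionals.
Variables (R : realType) (cplx : bool) (p : R).
Hypothesis p1 : 1 <= p.
Local Notation C := (complex.complex R).
Local Notation normc := (@complex.ComplexField.Normc.normc R).
Local Notation Re := (@complex.Re R).
Local Notation Im := (@complex.Im R).
Local Notation X := (in_Lp cplx p).
Local Notation V := (@volterra R).
Local Notation L1op := (L1op cplx p).
Local Notation functional := (bounded_functional cplx p).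
Implicit Types (f g h : R -> C) (r s : R -> R) (A B : (R -> C) -> (R -> C))
  (phi psi : (R -> C) -> C).

Lemma in_Lp0 : X (fun=> 0).
Proof. exact: (in_Lp_cst cplx p1 0). Qed.

Lemma functional0 phi : functional phi -> phi (fun=> 0) = 0.
Proof.
move=> [_ pl _]; have := pl 1 _ _ (inK1 _ _) in_Lp0 in_Lp0.
rewrite (_ : (fun y => _) = fun=> 0); last by apply/funext => x; rewrite mulr0 addr0.
by rewrite mul1r => /eqP; rewrite -subr_eq0 opprD addrA subrr sub0r oppr_eq0 => /eqP.
Qed.

Lemma functionalZ phi (a : C) f : functional phi -> inK cplx a -> X f ->
  phi (fun x => a * f x) = a * phi f.
Proof.
move=> fphi Ka Xf; have [_ pl _] := fphi; have := pl _ _ _ Ka Xf in_Lp0.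
rewrite functional0// addr0 => <-; congr phi.
by apply/funext => x; rewrite addr0.
Qed.

Lemma functional_lin phi psi (a b : C) : functional phi -> functional psi ->
  inK cplx a -> inK cplx b -> functional (fun f => a * phi f + b * psi f).
Proof.
move=> [pK pl [M pM]] [qK ql [N qN]] Ka Kb; split.
- move=> f Xf; apply: inK_lin => //; first exact: pK.
  by rewrite -[_ * _]addr0; apply: inK_lin => //; [exact: qK|exact: inK_real].
- by move=> c f g Kc Xf Xg; rewrite pl// ql//; ring.
- exists (normc a * M + normc b * N) => f Xf; apply: le_trans (le_normcD _ _) _.
  rewrite !ComplexField.Normc.normcM mulrDl; apply: lerD; rewrite -mulrA ler_wpM2l ?normc_ge0//.
    exact: pM.
  exact: qN.
Qed.

Lemma functional_sub phi psi : functional phi -> functional psi ->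
  functional (fun f => phi f - psi f).
Proof.
move=> fp fq; have := functional_lin fp fq (inK1 _ _) (inKN1 _ _).
by congr bounded_functional; apply/funext => f; rewrite mul1r mulN1r.
Qed.

Lemma functional_ae phi f g : functional phi -> X f -> X g -> ae01 f g -> phi f = phi g.
Proof.
move=> [_ pl [M pM]] Xf Xg fg; have Xh := in_Lp_opp_add p1 Xg Xf.
have h0 : ae01 (fun x => -1 * g x + f x) (fun=> 0).
  apply: ae01_trans (ae01_map (fun x z => -1 * g x + z) fg) _.
  by apply: ae01_of_all => x _; rewrite mulN1r addNr.
have := pM _ Xh; rewrite (ae0_lpnorm p1 Xh h0) mulr0 => h.
have /ComplexField.Normc.eq0_normc : normc (phi (fun x => -1 * g x + f x)) = 0.
  by apply/eqP; rewrite eq_le h normc_ge0.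
by rewrite (pl _ _ _ (inKN1 _ _) Xg Xf) mulN1r addrC => /eqP; rewrite subr_eq0 => /eqP.
Qed.

(* [cform f g] is the value at [1] of the convolution of [V f] and [V g]. *)
Definition cform f g : C :=
  complex.Complex (rform (Re \o f) (Re \o g) - rform (Im \o f) (Im \o g))
                  (rform (Re \o f) (Im \o g) + rform (Im \o f) (Re \o g)).

Lemma cform_sym f g : integrable01C f -> integrable01C g -> cform f g = cform g f.
Proof.
move=> [fR fI] [gR gI]; apply: complex_ext; rewrite /cform /=.
  by rewrite (rform_sym fR gR) (rform_sym fI gI).
by rewrite addrC (rform_sym fR gI) (rform_sym fI gR).
Qed.

Lemma Re_volterra f : Re \o V f = rvolterra (Re \o f).
Proof. by []. Qed.

Lemma Im_volterra f : Im \o V f = rvolterra (Im \o f).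
Proof. by []. Qed.

Lemma cform_volterra f g : integrable01C f -> integrable01C g -> cform (V f) g = cform f (V g).
Proof.
move=> [fR fI] [gR gI]; rewrite /cform !Re_volterra !Im_volterra.
rewrite (rform_rvolterra fR gR) (rform_rvolterra fI gI).
by rewrite (rform_rvolterra fR gI) (rform_rvolterra fI gR).
Qed.

Lemma ae01_cforml f g h : integrable01C f -> integrable01C g -> ae01 f g -> cform f h = cform g h.
Proof.
move=> [fR fI] [gR gI] fg; have eR := ae01_map (fun _ => Re) fg.
have eI := ae01_map (fun _ => Im) fg.
by rewrite /cform !(ae01_rforml _ fR gR eR) !(ae01_rforml _ fI gI eI).
Qed.

Lemma ae01_cformr f g h : integrable01C f -> integrable01C g -> integrable01C h ->
  ae01 f g -> cform h f = cform h g.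
Proof.
move=> fi gi hi fg.
by rewrite (cform_sym hi fi) (ae01_cforml h fi gi fg) (cform_sym gi hi).
Qed.

Lemma rform_ReC_lin (a : C) f g s : integrable01C f -> integrable01C g -> integrable01 s ->
  rform (Re \o (fun x => a * f x + g x)) s =
  Re a * rform (Re \o f) s + (- Im a * rform (Im \o f) s + rform (Re \o g) s).
Proof.
move=> [fR fI] [gR gI] si; have i := integrable01_lin (- Im a) fI gR.
have -> : Re \o (fun x => a * f x + g x) =
    fun x => Re a * (Re \o f) x + (- Im a * (Im \o f) x + (Re \o g) x).
  by apply/funext => x; rewrite /= ReC_lin.
rewrite (rform_linl (Re a) fR i si); congr (_ + _).
exact: (rform_linl (- Im a) fI gR si).
Qed.

Lemma rform_ImC_lin (a : C) f g s : integrable01C f -> integrable01C g -> integrable01 s ->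
  rform (Im \o (fun x => a * f x + g x)) s =
  Re a * rform (Im \o f) s + (Im a * rform (Re \o f) s + rform (Im \o g) s).
Proof.
move=> [fR fI] [gR gI] si; have i := integrable01_lin (Im a) fR gI.
have -> : Im \o (fun x => a * f x + g x) =
    fun x => Re a * (Im \o f) x + (Im a * (Re \o f) x + (Im \o g) x).
  by apply/funext => x; rewrite /= ImC_lin.
rewrite (rform_linl (Re a) fI i si); congr (_ + _).
exact: (rform_linl (Im a) fR gI si).
Qed.

Lemma cform_linl (a : C) f g h : integrable01C f -> integrable01C g -> integrable01C h ->
  cform (fun x => a * f x + g x) h = a * cform f h + cform g h.
Proof.
move=> fi gi [hR hI]; apply: complex_ext; rewrite ?ReD ?ReM ?ImD ?ImM /cform /=.
  rewrite (rform_ReC_lin a fi gi hR) (rform_ImC_lin a fi gi hI).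
  by repeat match goal with |- context [rform ?u ?v] => generalize (rform u v); intro end; ring.
rewrite (rform_ReC_lin a fi gi hI) (rform_ImC_lin a fi gi hR).
by repeat match goal with |- context [rform ?u ?v] => generalize (rform u v); intro end; ring.
Qed.

Lemma cform_le f g : integrable01C f -> integrable01C g ->
  normc (cform f g) <= norm1C f * norm1C g.
Proof.
move=> [fR fI] [gR gI]; apply: le_trans (normc_le_ReIm _) _ => /=.
apply: le_trans (lerD (ler_normB _ _) (ler_normD _ _)) _.
have := rform_le fR gR; have := rform_le fR gI; have := rform_le fI gR; have := rform_le fI gI.
rewrite /norm1C mulrDl !mulrDr.
repeat match goal with |- context [rform ?u ?v] => generalize (rform u v); intro end.
by repeat match goal with |- context [norm1 ?u] => generalize (norm1 u); intro end; lra.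
Qed.

Lemma inK_cform f g : X f -> X g -> inK cplx (cform f g).
Proof.
move=> [Kf _ _ _] [Kg _ _ _]; rewrite /inK; case: cplx Kf Kg => //= Kf Kg.
have f0 : Im \o f = fun=> 0 by apply/funext => x; apply/eqP; exact: Kf.
have g0 : Im \o g = fun=> 0 by apply/funext => x; apply/eqP; exact: Kg.
by rewrite f0 g0 rform0l rform0r addr0.
Qed.

Lemma cform_functional A g : L1op A -> X g -> functional (fun f => cform (A f) g).
Proof.
move=> oA Xg; have [AX Al [M M0 AM]] := oA; have gi := in_Lp_integrable p1 Xg; split.
- by move=> f Xf; exact: inK_cform (AX _ Xf) Xg.
- move=> a f h Ka Xf Xh.
  have i := in_Lp_integrable p1 (AX _ (in_Lp_lin p1 Ka Xf Xh)).
  have fi := in_Lp_integrable p1 (AX _ Xf); have hi := in_Lp_integrable p1 (AX _ Xh).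
  rewrite (ae01_cforml _ i (integrable01C_lin a fi hi) (Al _ _ _ Ka Xf Xh)).
  exact: cform_linl.
- exists (M * norm1C g) => f Xf.
  apply: le_trans (cform_le (in_Lp_integrable p1 (AX _ Xf)) gi) _.
  by rewrite mulrAC ler_wpM2r ?norm1C_ge0// AM.
Qed.

Lemma cform_functionalr A g : L1op A -> X g -> functional (fun f => cform g (A f)).
Proof.
move=> oA Xg; have [AX _ _] := oA; have gi := in_Lp_integrable p1 Xg.
have [h1 h2 [M h3]] := cform_functional oA Xg.
have E f : X f -> cform g (A f) = cform (A f) g.
  by move=> Xf; exact: cform_sym gi (in_Lp_integrable p1 (AX _ Xf)).
split; first by move=> f Xf; rewrite E//; exact: h1.
- move=> a f h Ka Xf Xh; rewrite (E _ (in_Lp_lin p1 Ka Xf Xh)) (E _ Xf) (E _ Xh).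
  exact: h2.
- by exists M => f Xf; rewrite E//; exact: h3.
Qed.

(** * The powers [V^n 1] and their density among primitives *)

Definition vpow (n : nat) : R -> C := iter n V (fun=> 1).

Lemma in_Lp_vpow n : X (vpow n).
Proof.
elim: n => [|n ih]; first exact: (in_Lp_cst cplx p1 1).
exact: (in_Lp_volterra p1 ih).
Qed.

(** With [q n] for [t^n / n!], multiplication by [t] sends [q n] to [(n + 1) * q n.+1]. Inserted in
    [D V = V D + V^2], this turns the formula for [q n] into the one for [q n.+1], multiplied by
    [n + 2]. *)
Lemma rvolterra_monomial n (x : R) : 0 <= x <= 1 ->
  rvolterra (fun t : R => t ^+ n / n`!%:R) x = x ^+ n.+1 / n.+1`!%:R.
Proof.
pose q n (t : R) := t ^+ n / n`!%:R.
have n0 m : (m`!%:R : R) != 0 by rewrite pnatr_eq0 -lt0n fact_gt0.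
have nS m : (m.+1%:R : R) != 0 by rewrite pnatr_eq0.
elim: n x => [|n ih] x x01.
  rewrite (_ : (fun t => _) = fun=> 1); last by apply/funext => t; rewrite expr0 fact0 divr1.
  by rewrite rvolterra_cst ?mul1r ?fact_geq ?expr1 ?divr1//; case/andP: x01.
have qi m : integrable01 (q m).
  apply: integrable01_continuous; apply: within_continuousM; apply: continuous_subspaceT => t.
    exact: exprn_continuous.
  exact: cvg_cst.
have xq m t : t * q m t = m.+1%:R * q m.+1 t + 0.
  rewrite addr0 /q exprS factS natrM invfM [RHS]mulrCA [m.+1%:R * _]mulrA.
  by rewrite mulfV ?nS// mul1r mulrA.
have := mulx_rvolterra x01 (qi n).
rewrite ih// (_ : (fun t => t * q n t) = fun t => n.+1%:R * q n.+1 t + 0); last first.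
  by apply/funext => t; exact: xq.
rewrite rvolterra_lin//; last exact: integrable01_cst.
rewrite rvolterra_cst ?mul0r ?addr0; last by case/andP: x01.
rewrite (@eq_rvolterra _ (rvolterra (q n)) (q n.+1))//.
rewrite -/(q n.+1 x) xq addr0 => h.
have {}h : n.+2%:R * q n.+2 x = n.+2%:R * rvolterra (q n.+1) x.
  by rewrite h -[in RHS]natr1 mulrDl mul1r.
by apply: (mulfI (nS n.+1)); rewrite -h.
Qed.

Lemma vpowE n (x : R) : 0 <= x <= 1 -> vpow n x = ((x ^+ n / n`!%:R)%:C)%C.
Proof.
elim: n x => [|n ih] x x01; first by rewrite expr0 fact0 divr1.
apply: complex_ext => /=.
  rewrite -/(rvolterra _ x) -rvolterra_monomial//.
  by apply: eq_rvolterra => // t t01; rewrite -/(vpow n) ih.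
rewrite -/(rvolterra _ x) (@eq_rvolterra _ _ (fun=> 0))// ?rvolterra_cst ?mul0r//.
  by case/andP: x01.
by move=> t t01; rewrite -/(vpow n) ih.
Qed.

Lemma in_Lp_monomial n : X (fun x : R => ((x ^+ n)%:C)%C).
Proof.
have [] // := @in_Lp_real R cplx p p1 (fun x => x ^+ n) 1 ler01.
by move=> x /andP[x0 x1]; rewrite ger0_norm ?exprn_ge0// exprn_ile1.
Qed.

Lemma functional_monomial phi n : functional phi -> phi (vpow n) = 0 ->
  phi (fun x : R => ((x ^+ n)%:C)%C) = 0.
Proof.
move=> fp p0; have n0 : (n`!%:R : R) != 0 by rewrite pnatr_eq0 -lt0n fact_gt0.
have XZ := in_Lp_lin p1 (inK_real cplx n`!%:R) (in_Lp_vpow n) in_Lp0.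
rewrite (functional_ae fp (in_Lp_monomial n) XZ); last first.
  apply: ae01_of_all => x x01; rewrite vpowE// addr0 -rmorphM/=.
  by rewrite mulrCA mulfV// mulr1.
have [_ pl _] := fp; rewrite (pl _ _ _ (inK_real _ _) (in_Lp_vpow n) in_Lp0).
by rewrite p0 functional0// mulr0 addr0.
Qed.

(** The power [x ^+ j] is carried along because the recursion of [bernstein] multiplies by [x] and
    [1 - x]. *)
Lemma functional_bernstein phi : functional phi -> (forall n, phi (vpow n) = 0) ->
  forall n j (u : nat -> R), X (fun x => ((x ^+ j * bernstein n u x)%:C)%C) /\
    phi (fun x => ((x ^+ j * bernstein n u x)%:C)%C) = 0.
Proof.
move=> fp p0; have [_ pl _] := fp; elim=> [|n ih] j u.
  have -> : (fun x : R => ((x ^+ j * bernstein 0 u x)%:C)%C) =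
      (fun x => ((u 0%N)%:C)%C * ((x ^+ j)%:C)%C + 0).
    by apply/funext => x; rewrite /= addr0 mulrC rmorphM.
  have Xj := in_Lp_monomial j; have Kr := inK_real cplx (u 0%N).
  split; first exact: (in_Lp_lin p1 Kr Xj in_Lp0).
  by rewrite (pl _ _ _ Kr Xj in_Lp0) functional_monomial// functional0// mulr0 addr0.
have [X1 z1] := ih j.+1 (u \o S); have [X2 z2] := ih j.+1 u; have [X3 z3] := ih j u.
have X4 := in_Lp_lin p1 (inKN1 _ _) X2 X3.
have -> : (fun x : R => ((x ^+ j * bernstein n.+1 u x)%:C)%C) =
    (fun x => 1 * ((x ^+ j.+1 * bernstein n (u \o S) x)%:C)%C +
      (-1 * ((x ^+ j.+1 * bernstein n u x)%:C)%C + ((x ^+ j * bernstein n u x)%:C)%C)).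
  apply/funext => x; rewrite mul1r mulN1r -rmorphN -!rmorphD /=; congr (_%:C)%C.
  by rewrite exprS; ring.
split; first exact: (in_Lp_lin p1 (inK1 _ _) X1 X4).
rewrite (pl _ _ _ (inK1 _ _) X1 X4) (pl _ _ _ (inKN1 _ _) X2 X3) z1 z2 z3.
by rewrite !mulr0 !addr0.
Qed.

(** Uniform approximation on the unit interval is approximation in [lpnorm], so a functional that
    kills the polynomials kills their uniform limits. *)
Lemma functional_rvolterra phi r : functional phi -> (forall n, phi (vpow n) = 0) ->
  integrable01 r ->
  X (fun x => ((rvolterra r x)%:C)%C) /\ phi (fun x => ((rvolterra r x)%:C)%C) = 0.
Proof.
move=> fp p0 ri; have mv : measurable_fun `[(0 : R), (1 : R)] (rvolterra r).
  by have := measurable_int _ (integrable01_rvolterra ri) => /measurable_EFinP.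
have bv x : 0 <= x <= 1 -> `|rvolterra r x| <= norm1 r by move=> x01; exact: rvolterra_le.
have [Xv _] := @in_Lp_real R cplx p p1 _ _ (norm1_ge0 r) mv bv; split => //.
have [_ pl [M pM]] := fp; set F := fun x => _.
apply: ComplexField.Normc.eq0_normc; apply/eqP; rewrite eq_le normc_ge0 andbT.
rewrite leNgt; apply/negP => n0.
have M0 : 0 < M.
  by have := lt_le_trans n0 (pM _ Xv); rewrite pmulr_lgt0// lt_neqAle lpnorm_ge0 andbT;
    case: eqVneq => // h; have := lt_le_trans n0 (pM _ Xv); rewrite -h mulr0 ltxx.
(* An approximation of accuracy [e] bounds [normc (phi F)] by [M * e], half of itself. *)
pose e := normc (phi F) / (2 * M).
have e0 : 0 < e by rewrite divr_gt0// mulr_gt0.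
have [n [u hu]] := weierstrass bv (fun e e0 => rvolterra_unif ri e0) e0.
have [Xq q0] := functional_bernstein fp p0 n 0 u.
have Xd := in_Lp_opp_add p1 Xq Xv.
have dE : (fun x => -1 * ((x ^+ 0 * bernstein n u x)%:C)%C + F x) =
    (fun x => ((rvolterra r x - bernstein n u x)%:C)%C).
  by apply/funext => x; rewrite expr0 mul1r mulN1r addrC /F -rmorphB.
have mb : measurable_fun `[(0 : R), (1 : R)] (bernstein n u).
  have [_ mb _ _] := Xq; rewrite (_ : bernstein n u =
    fun x => Re ((x ^+ 0 * bernstein n u x)%:C)%C) //.
  by apply/funext => x /=; rewrite expr0 mul1r.
have [_ dn] := @in_Lp_real R cplx p p1 (fun x => rvolterra r x - bernstein n u x) e
  (ltW e0) (measurable_funB mv mb) hu.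
have := pM _ Xd; rewrite (pl _ _ _ (inKN1 _ _) Xq Xv) q0 mulr0 add0r dE.
move=> /le_trans /(_ (ler_wpM2l (ltW M0) dn)); rewrite leNgt => /negP; apply.
rewrite /e -/F (_ : M * _ = normc (phi F) / 2); last by field; rewrite gt_eqF.
by rewrite ltr_pdivrMr// ltr_pMr// ltr1n.
Qed.

(* The powers [V^n 1] span the polynomials, which are uniformly dense among the primitives. *)
Lemma functional_volterra0 phi f : functional phi -> (forall n, phi (vpow n) = 0) -> X f ->
  phi (V f) = 0.
Proof.
move=> fp p0 Xf; have [fR fI] := in_Lp_integrable p1 Xf; have [Kf _ _ _] := Xf.
have [XR zR] := functional_rvolterra fp p0 fR; have [XI zI] := functional_rvolterra fp p0 fI.
have [_ pl _] := fp.
(* In the complex case the imaginary part enters through the scalar [i]; in the real case that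
   scalar is not admissible, but the imaginary part vanishes. *)
case c: cplx.
  have Ki : inK cplx ('i%C : C) by rewrite /inK c.
  rewrite (_ : V f = fun x => 'i%C * ((rvolterra (Im \o f) x)%:C)%C +
      ((rvolterra (Re \o f) x)%:C)%C); last first.
    apply/funext => x; apply: complex_ext; rewrite ?ReD ?ImD ?ReM ?ImM /=.
      by rewrite mul0r mulr0 subr0 add0r.
    by rewrite mulr0 mul1r add0r addr0.
  by rewrite (pl _ _ _ Ki XI XR) zR zI mulr0 addr0.
rewrite (_ : V f = fun x => ((rvolterra (Re \o f) x)%:C)%C)//.
apply/funext => x; apply: complex_ext => //=.
rewrite (_ : (fun t => _) = cst 0) ?Rintegral_cst ?mul0r//.
by apply/funext => t; have := Kf t; rewrite /inK c => /eqP.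
Qed.

End Functionals.

(** * Symmetry of the operators commuting with [V] *)

Section Commutant.
Variables (R : realType) (cplx : bool) (p : R).
Hypothesis p1 : 1 <= p.
Local Notation C := (complex.complex R).
Local Notation Re := (@complex.Re R).
Local Notation Im := (@complex.Im R).
Local Notation X := (in_Lp cplx p).
Local Notation V := (@volterra R).
Local Notation L1op := (L1op cplx p).
Local Notation Lpop := (Lpop cplx p).
Local Notation functional := (bounded_functional cplx p).
Local Notation vpow := (@vpow R).
Implicit Types (f g h : R -> C) (A B : (R -> C) -> (R -> C)).

Definition commV A : Prop := forall f, X f -> ae01 (A (V f)) (V (A f)).

Lemma in_Lp_iter_volterra n f : X f -> X (iter n V f).
Proof. by move=> Xf; elim: n => [//|n ih]; exact: (in_Lp_volterra p1 ih). Qed.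

Lemma cform_iter_volterra n f g : X f -> X g -> cform (iter n V f) g = cform f (iter n V g).
Proof.
move=> Xf Xg; elim: n g Xg => [//|n ih] g Xg.
rewrite iterS cform_volterra; last 2 first.
- exact: (in_Lp_integrable p1 (in_Lp_iter_volterra n Xf)).
- exact: (in_Lp_integrable p1 Xg).
by rewrite (ih _ (in_Lp_volterra p1 Xg)) -iterSr.
Qed.

Lemma commV_vpow A n : L1op A -> commV A -> ae01 (A (vpow n)) (iter n V (A (vpow 0))).
Proof.
move=> oA cA; have [AX _ _] := oA; have X0 := in_Lp_vpow cplx p1.
elim: n => [|n ih]; first exact: ae01_of_all.
apply: ae01_trans (cA _ (X0 n)) _; apply: ae01_of_all => x x01.
have i1 := in_Lp_integrable p1 (AX _ (X0 n)).
have i2 := in_Lp_integrable p1 (in_Lp_iter_volterra n (AX _ (X0 0%N))).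
exact: (ae01_volterra x01 i1 i2 ih).
Qed.

(** Commutation writes [A (V^m 1)] as [V^m (A 1)], and the symmetry of [V] passes [V^m] to the other
    argument. *)
Lemma cform_commV_vpow A m n : L1op A -> commV A ->
  cform (A (vpow m)) (vpow n) = cform (A (vpow 0)) (vpow (m + n)).
Proof.
move=> oA cA; have [AX _ _] := oA; have X0 := in_Lp_vpow cplx p1.
have Xk := AX _ (X0 0%N); have i1 := in_Lp_integrable p1 (AX _ (X0 m)).
have i2 := in_Lp_integrable p1 (in_Lp_iter_volterra m Xk).
rewrite (ae01_cforml _ i1 i2 (commV_vpow m oA cA)).
rewrite (cform_iter_volterra m Xk (X0 n)); congr cform.
by rewrite /vpow iterD.
Qed.

(* Both sides depend only on [m + n] for [f = V^m 1], [g = V^n 1]; then use density in [f]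
   and in [g]. *)
Lemma cform_commV A f g : L1op A -> commV A -> X f -> X g ->
  cform (A (V f)) (V g) = cform (V f) (A (V g)).
Proof.
move=> oA cA Xf Xg; have [AX _ _] := oA; have X0 := in_Lp_vpow cplx p1.
have oI := Lpop_L1op p1 (Lpop_id cplx p).
have step1 n : cform (A (V f)) (vpow n) = cform (V f) (A (vpow n)).
  have F1 := cform_functional p1 oA (X0 n).
  have F2 := cform_functional p1 oI (AX _ (X0 n)).
  have z m : cform (A (vpow m)) (vpow n) - cform (vpow m) (A (vpow n)) = 0.
    have i1 := in_Lp_integrable p1 (X0 m); have i2 := in_Lp_integrable p1 (AX _ (X0 n)).
    rewrite (cform_sym i1 i2) (cform_commV_vpow m n oA cA) (cform_commV_vpow n m oA cA).
    by rewrite addnC subrr.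
  have /eqP := functional_volterra0 p1 (functional_sub F1 F2) z Xf.
  by rewrite subr_eq0 => /eqP.
have F1 := cform_functionalr p1 oI (AX _ (in_Lp_volterra p1 Xf)).
have F2 := cform_functionalr p1 oA (in_Lp_volterra p1 Xf).
have z n : cform (A (V f)) (vpow n) - cform (V f) (A (vpow n)) = 0.
  by rewrite step1 subrr.
have /eqP := functional_volterra0 p1 (functional_sub F1 F2) z Xg.
by rewrite subr_eq0 => /eqP.
Qed.

(** [functional_volterra0] reaches primitives only, so [cform_commV] speaks of [V f] and [V g].
    Absorbing these two [V] into the form gives a symmetry valid for all [f] and [g]. *)
Definition bform f g : C := cform (V f) (V g).

Lemma bform_commV A f g : L1op A -> commV A -> X f -> X g -> bform (A f) g = bform f (A g).
Proof.
move=> oA cA Xf Xg; have [AX _ _] := oA.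
have iVA h : X h -> integrable01C (V (A h)).
  by move=> Xh; exact: (in_Lp_integrable p1 (in_Lp_volterra p1 (AX _ Xh))).
have iAV h : X h -> integrable01C (A (V h)).
  by move=> Xh; exact: (in_Lp_integrable p1 (AX _ (in_Lp_volterra p1 Xh))).
have iV := in_Lp_integrable p1 (in_Lp_volterra p1 Xf).
rewrite /bform -(ae01_cforml _ (iAV _ Xf) (iVA _ Xf) (cA _ Xf)).
rewrite -(ae01_cformr (iAV _ Xg) (iVA _ Xg) iV (cA _ Xg)).
exact: cform_commV.
Qed.

Lemma bform_sym f g : X f -> X g -> bform f g = bform g f.
Proof.
by move=> Xf Xg; exact: (cform_sym (in_Lp_integrable p1 (in_Lp_volterra p1 Xf))
  (in_Lp_integrable p1 (in_Lp_volterra p1 Xg))).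
Qed.

Lemma bform_functional A g : L1op A -> X g -> functional (fun f => bform (A f) g).
Proof.
move=> oA Xg.
exact: (cform_functional p1 (L1op_volterra p1 oA) (in_Lp_volterra p1 Xg)).
Qed.

Lemma bform_functionalr A g : L1op A -> X g -> functional (fun f => bform g (A f)).
Proof.
move=> oA Xg.
exact: (cform_functionalr p1 (L1op_volterra p1 oA) (in_Lp_volterra p1 Xg)).
Qed.

Lemma ae01_bforml f g h : X f -> X g -> ae01 f g -> bform f h = bform g h.
Proof.
move=> Xf Xg fg; have fi := in_Lp_integrable p1 Xf; have gi := in_Lp_integrable p1 Xg.
apply: ae01_cforml; [exact: (in_Lp_integrable p1 (in_Lp_volterra p1 Xf))|
  exact: (in_Lp_integrable p1 (in_Lp_volterra p1 Xg))|].
by apply: ae01_of_all => x x01; exact: (ae01_volterra x01 fi gi fg).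
Qed.

Lemma commV_comp A B : L1op A -> commV A -> Lpop B -> commV B -> commV (A \o B).
Proof.
move=> oA cA [BX _ _] cB f Xf.
have h := L1op_ae p1 oA (BX _ (in_Lp_volterra p1 Xf)) (in_Lp_volterra p1 (BX _ Xf)) (cB _ Xf).
exact: (ae01_trans h (cA _ (BX _ Xf))).
Qed.

Lemma commV_iter A n : Lpop A -> commV A -> commV (iter n A).
Proof.
move=> oA cA; elim: n => [|n ih]; first by move=> f Xf; exact: ae01_of_all.
exact: (commV_comp (Lpop_L1op p1 oA) cA (Lpop_iter p1 n oA) ih).
Qed.

Definition commX A f : R -> C := fun x => mulX (A f) x - A (mulX f) x.

Lemma L1op_commX A : Lpop A -> L1op (commX A).
Proof.
move=> oA; have o1 := Lpop_L1op p1 oA.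
exact: (L1op_sub p1 (L1op_mulX p1 o1) (L1op_comp p1 o1 (Lpop_mulX cplx p1))).
Qed.

(* Because [mulX V - V mulX = V^2] commutes with [A]. *)
Lemma commV_commX A : Lpop A -> commV A -> commV (commX A).
Proof.
move=> oA cA f Xf; have [AX Al _] := oA; have o1 := Lpop_L1op p1 oA.
have XV := in_Lp_volterra p1; have XX := in_Lp_mulX p1.
have XVf := XV _ _ Xf; have XVVf := XV _ _ XVf.
have XVX := XV _ _ (XX _ _ Xf).
have Xs := in_Lp_lin p1 (inK1 _ cplx) XVX XVVf.
have int g (Xg : X g) := in_Lp_integrable p1 Xg.
have e1 : ae01 (mulX (A (V f))) (fun x => V (mulX (A f)) x + V (V (A f)) x).
  apply: ae01_trans (ae01_map (fun x z => (x%:C)%C * z) (cA _ Xf)) _.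
  by apply: ae01_of_all => x x01; exact: (volterra_mulX x01 (int _ (AX _ Xf))).
have e2 : ae01 (mulX (V f)) (fun x => 1 * V (mulX f) x + V (V f) x).
  by apply: ae01_of_all => x x01; rewrite mul1r; exact: (volterra_mulX x01 (int _ Xf)).
have e3 := L1op_ae p1 o1 (XX _ _ XVf) Xs e2.
have e4 := ae01_trans e3 (Al _ _ _ (inK1 _ cplx) XVX XVVf).
have e5 : ae01 (A (V (V f))) (V (V (A f))).
  apply: ae01_trans (cA _ XVf) _; apply: ae01_of_all => x x01.
  exact: (ae01_volterra x01 (int _ (AX _ XVf)) (int _ (XV _ _ (AX _ Xf))) (cA _ Xf)).
have e6 := ae01_map2 (fun _ z w => 1 * z + w) (cA _ (XX _ _ Xf)) e5.
have e7 := ae01_map2 (fun _ z w => z - w) e1 (ae01_trans e4 e6).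
apply: ae01_trans e7 _; apply: ae01_of_all => x x01 /=.
rewrite (_ : commX A f = fun x => -1 * A (mulX f) x + mulX (A f) x); last first.
  by apply/funext => y; exact: opp_addE.
rewrite (volterra_lin _ x01 (int _ (AX _ (XX _ _ Xf))) (int _ (XX _ _ (AX _ Xf)))).
by ring.
Qed.

Lemma bform_mulX A f g : Lpop A -> X f -> X g ->
  bform (mulX (A f)) g = bform (commX A f) g + bform (A (mulX f)) g.
Proof.
move=> oA Xf Xg; have [AX _ _] := oA; have [cX _ _] := L1op_commX oA.
have F := bform_functional (Lpop_L1op p1 (Lpop_id cplx p)) Xg.
have [_ pl _] := F.
have E : (fun y => 1 * commX A f y + A (mulX f) y) = mulX (A f).
  by apply/funext => x; rewrite mul1r /commX subrK.
have h : bform (fun y => 1 * commX A f y + A (mulX f) y) g =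
    1 * bform (commX A f) g + bform (A (mulX f)) g.
  exact: (pl _ _ _ (inK1 _ cplx) (cX _ Xf) (AX _ (in_Lp_mulX p1 Xf))).
by rewrite -E h (mul1r (bform _ g)).
Qed.

(** The value is the integral of [t^3 (1 - t)^3 / 36], as [V^3 1] is [t^3 / 6]. *)
Lemma bform_vpow11 : bform (vpow 1) (vpow 1) != 0.
Proof.
have X2 := in_Lp_vpow cplx p1 2; have [iR iI] := in_Lp_integrable p1 X2.
pose q (t : R) := t ^+ 3 / 3`!%:R.
pose k (t : R) := q t * q (1 - t).
have rvE t : 0 <= t <= 1 -> rvolterra (Re \o vpow 2) t = q t.
  by move=> t01; have := vpowE 3 t01 => /(congr1 Re).
have ki : integrable01 k.
  apply: eq_integrable01 (integrable01_continuous (rform_integrand_continuous iR iR)).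
  by move=> x x01; rewrite !rvE//; exact: onem01.
have rE : rform (Re \o vpow 2) (Re \o vpow 2) = rvolterra k 1.
  rewrite rformE; apply: eq_Rintegral => t.
  by rewrite inE/= in_itv/= => t01; rewrite !rvE//; exact: onem01.
have i0 : rform (Im \o vpow 2) (Im \o vpow 2) = 0.
  rewrite (ae01_rforml _ iI (integrable01_cst 0)) ?rform0l//.
  by apply: ae01_of_all => x x01; exact: (congr1 Im (vpowE 2 x01)).
have d0 : (0 : R) < (3`!%:R)^-1 by rewrite invr_gt0 ltr0n fact_gt0.
have k0 : 0 < rvolterra k 1.
  have kE t : k t = (3`!%:R)^-1 ^+ 2 * (t ^+ 3 * (1 - t) ^+ 3).
    by rewrite /k /q; move: (_^-1) => d; ring.
  (* Between the quarter points both [t] and [1 - t] are at least [1 / 4]. *)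
  apply: (@rvolterra_gt0 _ _ ((3`!%:R)^-1 ^+ 2 * ((1 / 4) ^+ 3 * (1 / 4) ^+ 3)) ki).
  - by rewrite !mulr_gt0 ?exprn_gt0.
  - move=> t /andP[t0 t1]; rewrite kE mulr_ge0 ?exprn_ge0 ?(ltW d0)//.
    by rewrite mulr_ge0 ?exprn_ge0 ?subr_ge0.
  - move=> t t4; rewrite kE; apply: ler_wpM2l; first by rewrite exprn_ge0 ?(ltW d0).
    clear -t4; by apply: ler_pM; rewrite ?exprn_ge0 ?lerXn2r ?nnegrE; lra.
have E : Re (bform (vpow 1) (vpow 1)) =
  rform (Re \o vpow 2) (Re \o vpow 2) - rform (Im \o vpow 2) (Im \o vpow 2) by [].
apply/eqP => /(congr1 Re); rewrite E rE i0 subr0 => h.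
by move: k0; rewrite h ltxx.
Qed.

End Commutant.

Opaque cform bform.

(** * Consequences of a weakly dense projective orbit *)

Section WeaklySupercyclic.
Variables (R : realType) (cplx : bool) (p : R).
Hypothesis p1 : 1 <= p.
Local Notation C := (complex.complex R).
Local Notation normc := (@complex.ComplexField.Normc.normc R).
Local Notation X := (in_Lp cplx p).
Local Notation V := (@volterra R).
Local Notation functional := (bounded_functional cplx p).
Local Notation vpow := (@vpow R).
Variables (T : (R -> C) -> (R -> C)) (u : R -> C).
Hypotheses (oT : Lpop cplx p T) (cT : commV cplx p T) (Xu : X u).
Hypothesis dense : forall g : R -> C, X g ->
  forall (m : nat) (phi : 'I_m -> (R -> C) -> C), (forall i, functional (phi i)) ->
  forall eps : R, 0 < eps ->
  exists (z : C) (n : nat), inK cplx z /\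
    forall i, normc (phi i (fun t => z * iter n T u t) - phi i g) < eps.
Implicit Types (f g : R -> C) (phi psi : (R -> C) -> C).

Local Notation orb n := (iter n T u).

Lemma in_Lp_orbit n f : X f -> X (iter n T f).
Proof. by have [h _ _] := Lpop_iter p1 n oT; exact: h. Qed.

(** Weak density enters the argument only in this form: two functionals tested at once, with the
    scalar pulled out. *)
Lemma dense2 phi psi g (eps : R) : functional phi -> functional psi -> X g -> 0 < eps ->
  exists (z : C) (n : nat), normc (z * phi (orb n) - phi g) < eps /\
    normc (z * psi (orb n) - psi g) < eps.
Proof.
move=> fp fq Xg e0; pose F (i : 'I_2) := if i == ord0 then phi else psi.
have fF i : functional (F i) by rewrite /F; case: ifP.
have [z [n [Kz h]]] := dense Xg fF e0; exists z, n.
have Xn := in_Lp_orbit n Xu.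
have h0 := h ord0; have h1 := h (lift ord0 ord0); rewrite /F /= in h0 h1.
by rewrite -(functionalZ p1 fp Kz Xn) -(functionalZ p1 fq Kz Xn); split.
Qed.

(** The radius [normc (phi g)] already excludes every vector killed by [phi]. *)
Lemma functional_orbit0 phi g : functional phi -> (forall n, phi (orb n) = 0) -> X g -> phi g = 0.
Proof.
move=> fp p0 Xg; apply: ComplexField.Normc.eq0_normc.
apply/eqP; rewrite eq_le normc_ge0 andbT leNgt; apply/negP => n0.
have [z [n []]] := dense2 fp fp Xg n0.
by rewrite p0 mulr0 sub0r normcN ltxx.
Qed.

(* On the orbit the ratio [alpha / beta] is a natural number, so it cannot approach [-1]. *)
Lemma no_ratio_opp1 alpha beta g : functional alpha -> functional beta ->
  (forall n, alpha (orb n) = n%:R * beta (orb n)) -> X g ->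
  alpha g + beta g = 0 -> beta g = 0.
Proof.
move=> fa fb ab Xg abg; apply: ComplexField.Normc.eq0_normc.
apply/eqP; rewrite eq_le normc_ge0 andbT leNgt; apply/negP => n0.
pose e := normc (beta g) / 4; have e0 : 0 < e by rewrite divr_gt0.
have [z [n []]] := dense2 fa fb Xg e0; rewrite ab.
set w := z * beta (orb n) => h1 h2.
(* The two errors add up to [n.+1] times [w]. Hence [w] has modulus below [2 * e] and [beta g] below
   [3 * e], against the choice of [e] as a quarter. *)
have E : (z * (n%:R * beta (orb n)) - alpha g) + (w - beta g) = w *+ n.+1.
  have -> : alpha g = - beta g by apply/eqP; rewrite -addr_eq0 abg.
  by rewrite -[w *+ n.+1]mulr_natl -natr1 /w; ring.
have := le_lt_trans (le_normcD _ _) (ltrD h1 h2); rewrite E normcMn => h3.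
have h4 : normc (beta g) <= normc w + normc (w - beta g).
  rewrite -(normcN (w - beta g)); apply: le_trans (le_normcD _ _).
  by rewrite opprB addrC subrK.
have h5 : normc w <= normc w *+ n.+1 by rewrite mulrS lerDl mulrn_wge0// normc_ge0.
have e4 : 4 * e = normc (beta g) by rewrite /e mulrC divfK.
move: h2 h3 h4 h5 e4 e0; clear.
move: (normc w) (normc (w - beta g)) (normc (beta g)) => a b c; move: (a *+ n.+1) => d; lra.
Qed.

Lemma beta_orbit_unique alpha beta m m' : functional alpha -> functional beta ->
  (forall n, alpha (orb n) = n%:R * beta (orb n)) ->
  beta (orb m) != 0 -> beta (orb m') != 0 -> m = m'.
Proof.
(* As [alpha + beta] is [n.+1] times [beta] on [orb n], these coefficients make it vanish on
   [x * orb m' - y * orb m], where [beta] is [m - m'] times a nonzero product. *)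
move=> fa fb ab b0 b0'; pose x := m.+1%:R * beta (orb m); pose y := m'.+1%:R * beta (orb m').
have Xm := in_Lp_orbit m Xu; have Xm' := in_Lp_orbit m' Xu.
have [Kb bl _] := fb; have [_ al _] := fa.
have Kn n (w : C) : inK cplx w -> inK cplx (n%:R * w).
  move=> Kw; elim: n => [|n ih]; first by rewrite mul0r; exact: inK_real.
  by rewrite -natr1 addrC mulrDl; apply: inK_lin => //; exact: inK1.
have Kx : inK cplx x by apply: Kn; exact: Kb.
have Ky : inK cplx (- y).
  have := inK_lin (inKN1 R cplx) (Kn m'.+1 _ (Kb _ Xm')) (inK_real cplx (0 : R)).
  by rewrite addr0 mulN1r.
have Xz := in_Lp_lin p1 Ky Xm (in_Lp0 cplx p1).
have E phi : functional phi -> phi (fun t => x * orb m' t + (- y * orb m t + 0)) =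
    x * phi (orb m') - y * phi (orb m).
  move=> fphi; have [_ pl _] := fphi.
  rewrite (pl _ _ _ Kx Xm' Xz) (pl _ _ _ Ky Xm (in_Lp0 cplx p1)).
  by rewrite (functional0 p1 fphi) addr0 mulNr.
have := no_ratio_opp1 fa fb ab (in_Lp_lin p1 Kx Xm' Xz).
rewrite !E// !ab => /(_ _) h.
have {h} : x * beta (orb m') - y * beta (orb m) = 0.
  by apply: h; rewrite /x /y -(natr1 m) -(natr1 m'); ring.
have -> : x * beta (orb m') - y * beta (orb m) =
    (m.+1%:R - m'.+1%:R) * (beta (orb m) * beta (orb m')) by rewrite /x /y; ring.
move/eqP; rewrite mulf_eq0 mulf_eq0 (negbTE b0) (negbTE b0') !orbF subr_eq0.
by rewrite eqr_nat => /eqP [].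
Qed.

(** Projective orbit vectors close to some [g] with [beta g != 0] must be multiples of [orb m]. The
    combination [chi] of [psi] and [beta] vanishes on those, hence at [g]. *)
Lemma functional_multiple beta m : functional beta ->
  beta (orb m) != 0 -> (forall n, beta (orb n) != 0 -> n = m) ->
  forall psi g, functional psi -> X g -> beta (orb m) * psi g = psi (orb m) * beta g.
Proof.
move=> fb b0 uniq psi g fq Xg; pose e := orb m.
have Xe : X e := in_Lp_orbit m Xu.
have [Kb _ _] := fb; have [Kq _ _] := fq.
have Kq' : inK cplx (- psi e).
  have := inK_lin (inKN1 R cplx) (Kq _ Xe) (inK_real cplx (0 : R)).
  by rewrite addr0 mulN1r.
pose chi f := beta e * psi f + - psi e * beta f.
have fc : functional chi := functional_lin fq fb (Kb _ Xe) Kq'.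
have chie : chi e = 0 by rewrite /chi; ring.
suff c0 : chi g = 0.
  by apply/eqP; rewrite -subr_eq0 -mulNr; apply/eqP.
have nz f : X f -> beta f != 0 -> chi f = 0.
  move=> Xf bf; apply: ComplexField.Normc.eq0_normc.
  apply/eqP; rewrite eq_le normc_ge0 andbT leNgt; apply/negP => n0.
  have nb : 0 < normc (beta f).
    rewrite lt_neqAle normc_ge0 andbT eq_sym; apply/eqP => /ComplexField.Normc.eq0_normc h.
    by rewrite h eqxx in bf.
  (* Radius [normc (beta f)] keeps [beta] nonzero and pins the index to [m]; radius [normc (chi f)]
     then contradicts [chi (orb m) = 0]. *)
  pose eps := Num.min (normc (chi f)) (normc (beta f)).
  have e0 : 0 < eps by rewrite lt_min n0 nb.
  have [z [n []]] := dense2 fc fb Xf e0; rewrite !lt_min => /andP[h1 _] /andP[_ h2].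
  have nm : n = m.
    apply: uniq; apply/eqP => h; move: h2.
    by rewrite h mulr0 sub0r normcN ltxx.
  by move: h1; rewrite nm -/e chie mulr0 sub0r normcN ltxx.
(* Where [beta g = 0], adding [orb m] makes [beta] nonzero and leaves [chi] unchanged. *)
case: (eqVneq (beta g) 0) => [bg|]; last exact: nz.
have [_ bl _] := fb; have [_ cl _] := fc.
have := nz _ (in_Lp_lin p1 (inK1 R cplx) Xe Xg).
rewrite (bl _ _ _ (inK1 _ _) Xe Xg) (cl _ _ _ (inK1 _ _) Xe Xg) bg addr0 chie mulr0 add0r mul1r.
exact.
Qed.

(** After [V], evaluation at a point is bounded on [L_p]. Two such evaluations will provide
    functionals that are not proportional. *)
Lemma functional_eval (a : R) : 0 <= a <= 1 -> functional (fun f => V f a).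
Proof.
move=> a01; split.
- by move=> f Xf; have [K _ _ _] := in_Lp_volterra p1 Xf; exact: K.
- move=> c f g Kc Xf Xg.
  exact: (volterra_lin c a01 (in_Lp_integrable p1 Xf) (in_Lp_integrable p1 Xg)).
- exists 4 => f Xf; apply: le_trans (norm1C_le_lpnorm p1 Xf).
  exact: (volterra_le a01 (in_Lp_integrable p1 Xf)).
Qed.

(** A nonzero value would make all bounded functionals proportional, against the independence of the
    evaluations of [V f] at [1] and [1 / 2], tested on [1] and [V 1]. *)
Lemma beta_orbit0 alpha beta n : functional alpha -> functional beta ->
  (forall n, alpha (orb n) = n%:R * beta (orb n)) -> beta (orb n) = 0.
Proof.
move=> fa fb ab; apply/eqP/negPn/negP => b0.
have M := functional_multiple fb b0 (fun m h => beta_orbit_unique fa fb ab h b0).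
have a1 : 0 <= (1 : R) <= 1 by lra.
have a2 : 0 <= (1 / 2 : R) <= 1 by lra.
have X0 := in_Lp_vpow cplx p1 0; have X1 := in_Lp_vpow cplx p1 1.
have m10 := M _ _ (functional_eval a1) X0; have m11 := M _ _ (functional_eval a1) X1.
have m20 := M _ _ (functional_eval a2) X0; have m21 := M _ _ (functional_eval a2) X1.
have v0 (a : R) : 0 <= a <= 1 -> V (vpow 0) a = (a%:C)%C.
  by move=> a01; rewrite -[V _]/(vpow 1) vpowE// expr1 divr1.
have v1 (a : R) : 0 <= a <= 1 -> V (vpow 1) a = ((a ^+ 2 / 2)%:C)%C.
  by move=> a01; rewrite -[V _]/(vpow 2) vpowE.
(* Both rows of evaluations are proportional to the pair of values of [beta], so their determinant
   should vanish; it equals [1 * 1/8 - 1/2 * 1/2 = - 1/8]. *)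
have det (B x0 x1 y0 y1 c d b0' b1 : C) : B * x0 = c * b0' -> B * x1 = c * b1 ->
    B * y0 = d * b0' -> B * y1 = d * b1 -> B ^+ 2 * (x0 * y1 - x1 * y0) = 0.
  move=> e0 e1 f0 f1; transitivity ((B * x0) * (B * y1) - (B * x1) * (B * y0)); first by ring.
  by rewrite e0 e1 f0 f1; ring.
have D := det _ _ _ _ _ _ _ _ _ m10 m11 m20 m21.
rewrite (v0 _ a1) (v0 _ a2) (v1 _ a1) (v1 _ a2) -!rmorphM -rmorphB in D.
move/eqP: D; rewrite mulf_eq0 expf_eq0 /= (negbTE b0) /=.
rewrite eq_complex /= eqxx andbT => /eqP h.
have : (1 : R) * ((1 / 2) ^+ 2 / 2) - (1 ^+ 2 / 2) * (1 / 2) = - (1 / 8) by field.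
rewrite h; lra.
Qed.

(** * Symmetry of the multiplication by the variable, and the contradiction *)

Local Notation b := (@bform R).
Local Notation dT := (@commX R T).

Lemma bform_T f g : X f -> X g -> b (T f) g = b f (T g).
Proof. exact: (bform_commV p1 (Lpop_L1op p1 oT) cT). Qed.

Lemma bform_commX_iter n f g : X f -> X g -> b (dT (iter n T f)) g = b f (dT (iter n T g)).
Proof.
have o := L1op_commX p1 oT; have c := commV_commX p1 oT cT.
have oi := Lpop_iter p1 n oT; have ci := commV_iter p1 n oT cT.
move=> Xf Xg; exact: (bform_commV p1 (L1op_comp p1 o oi) (commV_comp p1 o c oi ci) Xf Xg).
Qed.

Lemma in_Lp_commX f : X f -> X (dT f).
Proof. by have [h _ _] := L1op_commX p1 oT; exact: h. Qed.

(** Moving [mulX] past one factor [T] leaves a term with [T'], and the symmetry of the [T' T^k]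
    makes all [n] such terms equal. Each step passes one [T] to the second argument, whence the free
    [m]. Having [T u] there for [m = 0], and not [u], makes the resulting term carry [orb n] rather
    than [orb n.-1]. *)
Lemma bform_mulX_orbit n m :
  b (mulX (orb n)) (orb m.+1) =
  b (mulX u) (orb (n + m).+1) + n%:R * b (orb (n + m)) (dT u).
Proof.
have Xo k := in_Lp_orbit k Xu; have XX := in_Lp_mulX p1.
elim: n m => [|n ih] m; first by rewrite mul0r addr0.
rewrite iterS (bform_mulX p1 oT (Xo n) (Xo m.+1)).
rewrite (bform_T (XX _ _ (Xo n)) (Xo m.+1)) -(iterS m.+1) ih.
rewrite (bform_commX_iter n Xu (Xo m.+1)) -iterD addnS.
rewrite -(bform_commX_iter 0 Xu (Xo (n + m).+1)) /=.
rewrite (bform_sym p1 (in_Lp_commX Xu) (Xo (n + m).+1)).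
rewrite ?addSn ?addnS -natr1.
move: (b _ _) (b _ _) => c d; ring.
Qed.

Lemma orbit_not_weakly_dense : False.
Proof.
have Xo k := in_Lp_orbit k Xu; have XX := in_Lp_mulX p1; have [TX _ _] := oT.
have oI := Lpop_L1op p1 (Lpop_id cplx p).
have oX := Lpop_L1op p1 (Lpop_mulX cplx p1).
have oC := L1op_commX p1 oT.
have XdTu := in_Lp_commX Xu.
have XTXu := TX _ (XX _ _ Xu).
have fb : functional (fun f => b f (dT u)) := bform_functional p1 oI XdTu.
have fa : functional (fun f => b (mulX f) (T u) - b f (T (mulX u))).
  exact: (functional_sub (bform_functional p1 oX (TX _ Xu)) (bform_functional p1 oI XTXu)).
(* By symmetry [b (mulX u) (orb n.+1)] is [b (orb n) (T (mulX u))], the term subtracted in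
   [alpha]. *)
have ab n : b (mulX (orb n)) (T u) - b (orb n) (T (mulX u)) = n%:R * b (orb n) (dT u).
  have := bform_mulX_orbit n 0; rewrite addn0 /= => ->.
  rewrite -(bform_T (XX _ _ Xu) (Xo n)) (bform_sym p1 XTXu (Xo n)).
  by rewrite addrAC subrr add0r.
have z1 n : b (orb n) (dT u) = 0 := beta_orbit0 n fa fb ab.
have z2 f : X f -> b f (dT u) = 0 by exact: (functional_orbit0 fb z1).
(* The symmetry of [T' T^k], then of [T'], shifts all powers of [T] onto [f] and leaves [T' u]. *)
have z3 f k : X f -> b f (dT (orb k)) = 0.
  move=> Xf; rewrite -(bform_commX_iter k Xf Xu).
  by rewrite (bform_commX_iter 0 (in_Lp_orbit k Xf) Xu); exact: z2 (in_Lp_orbit k Xf).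
have z4 f g : X f -> X g -> b f (dT g) = 0.
  move=> Xf Xg; exact: (functional_orbit0 (bform_functionalr p1 oC Xf) (fun k => z3 f k Xf) Xg).
(* Since [b] does not see [T'], [mulX] and [T] can be exchanged under the form. *)
have s1 f g : X f -> X g -> b (mulX (T f)) g = b (mulX f) (T g).
  move=> Xf Xg; rewrite (bform_mulX p1 oT Xf Xg) (bform_T (XX _ _ Xf) Xg).
  by rewrite (bform_sym p1 (in_Lp_commX Xf) Xg) z4// add0r.
have s2 n g : X g -> b (mulX (orb n)) g = b (mulX u) (iter n T g).
  elim: n g => [//|n ih] g Xg; rewrite iterS (s1 _ _ (Xo n) Xg) (ih _ (TX _ Xg)).
  by rewrite -iterSr.
(* Both sides equal [b (mulX u) (orb (n + k))]. *)
have s3 n k : b (mulX (orb n)) (orb k) = b (orb n) (mulX (orb k)).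
  rewrite (bform_sym p1 (Xo n) (XX _ _ (Xo k))) (s2 n _ (Xo k)) (s2 k _ (Xo n)).
  by rewrite -!iterD addnC.
(* Density now replaces the orbit vectors by arbitrary ones, one argument at a time. *)
have s4 f k : X f -> b (mulX f) (orb k) = b f (mulX (orb k)).
  move=> Xf; apply/eqP; rewrite -subr_eq0; apply/eqP.
  have F := functional_sub (bform_functional p1 oX (Xo k)) (bform_functional p1 oI (XX _ _ (Xo k))).
  by apply: (functional_orbit0 F _ Xf) => n; rewrite s3 subrr.
have s5 f g : X f -> X g -> b (mulX f) g = b f (mulX g).
  move=> Xf Xg; apply/eqP; rewrite -subr_eq0; apply/eqP.
  have F := functional_sub (bform_functionalr p1 oI (XX _ _ Xf)) (bform_functionalr p1 oX Xf).
  by apply: (functional_orbit0 F _ Xg) => n; rewrite s4// subrr.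
have Xv := in_Lp_vpow cplx p1.
(* Here [D 1 = V 1] and [D (V 1) = 2 V^2 1]; as [V] is [b]-symmetric, the equality reads
   [b (V 1) (V 1) = 2 * b (V 1) (V 1)]. *)
have h := s5 _ _ (Xv 0%N) (Xv 1%N).
have e1 : ae01 (mulX (vpow 0)) (vpow 1).
  by apply: ae01_of_all => x x01; rewrite (vpowE 1 x01) expr1 divr1 /mulX mulr1.
have X2 := in_Lp_lin p1 (inK_real cplx 2) (Xv 2%N) (in_Lp0 cplx p1).
have E2 (x : R) : x * (x ^+ 1 / 1`!%:R) = 2 * (x ^+ 2 / 2`!%:R).
  have -> : 2`! = 2%N by [].
  have -> : 1`! = 1%N by [].
  rewrite divr1 expr1 expr2 [RHS]mulrCA mulfV; first by rewrite mulr1.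
  by rewrite pnatr_eq0.
have e2 : ae01 (mulX (vpow 1)) (fun x => (2%:C)%C * vpow 2 x + 0).
  apply: ae01_of_all => x x01; rewrite /mulX (vpowE 1 x01) (vpowE 2 x01) addr0 -!rmorphM.
  exact: (congr1 (fun y => (y%:C)%C) (E2 x)).
have l := ae01_bforml p1 (vpow 1) (XX _ _ (Xv 0%N)) (Xv 1%N) e1.
have r := ae01_bforml p1 (vpow 0) (XX _ _ (Xv 1%N)) X2 e2.
have F := bform_functional p1 oI (Xv 0%N); have [_ Fl _] := F.
have r2 := Fl _ _ _ (inK_real cplx 2) (Xv 2%N) (in_Lp0 cplx p1).
have F0 := functional0 p1 F.
have sh : b (vpow 2) (vpow 0) = b (vpow 1) (vpow 1).
  have i1 := in_Lp_integrable p1 (Xv 2%N); have i2 := in_Lp_integrable p1 (Xv 1%N).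
  exact: (cform_volterra i1 i2).
have := bform_vpow11 cplx p1.
move: h; rewrite l (bform_sym p1 (Xv 0%N) (XX _ _ (Xv 1%N))) r.
rewrite r2 F0 addr0 sh => h.
have : b (vpow 1) (vpow 1) = 0.
  have : ((2%:C)%C - 1) * b (vpow 1) (vpow 1) = 0 by rewrite mulrBl mul1r -h subrr.
  rewrite (_ : (2%:C)%C - 1 = 1); last by rewrite rmorph_nat; ring.
  by rewrite mul1r.
by move=> ->; rewrite eqxx.
Qed.

End WeaklySupercyclic.

Theorem theorem1p1 (R : realType) (cplx : bool) (p : R)
  (T : (R -> complex.complex R) -> (R -> complex.complex R)) :
  1 <= p ->
  bounded_op cplx p T ->
  commutes_with_volterra cplx p T ->
  ~ weakly_supercyclic cplx p T.
Proof.
move=> p1 bT cT [u [Xu dense]].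
have oT := bounded_op_Lpop p1 bT; have [TX _ _] := oT.
apply: (orbit_not_weakly_dense p1 oT _ Xu dense) => f Xf; apply: ae01_sub0.
have Xd := in_Lp_sub p1 (TX _ (in_Lp_volterra p1 Xf)) (in_Lp_volterra p1 (TX _ Xf)).
exact: (lpnorm_eq0 p1 Xd (cT _ Xf)).
Qed.
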